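(* Let $G$ be a group of type $\mathrm{FP}$ with $\operatorname{cd}(G)<\infty$, let $1\neq c\in Z(G)$ be a non-trivial central element, and suppose that $\Gamma=G/\langle c\rangle$ is of type $\mathrm{VFP}$. Let $N$ be a $\mathbb{Z}\Gamma$-module of type $\mathrm{FP}_\infty$ over $\mathbb{Z}\Gamma$ with $n=\operatorname{pd}_{\mathbb{Z}G}(N)<\infty$. Then $N$ has a finite type $\mathbb{Z}\Gamma$-projective resolution $M_\bullet=(M_j,\partial_j)_{j\ge 0}$ which is $2$-periodic in degrees $\ge n-1$. In particular, suppose that $G$ is of type $\mathrm{FL}$, that $N=\mathbb{Z}$ is the trivial $\mathbb{Z}\Gamma$-module, and that $F_\bullet\to\mathbb{Z}$ is a finite type free resolution over $\mathbb{Z}G$ of length $n=\operatorname{cd}(G)<\infty$. Then $$r:=\sum_{i\equiv 0\ (\mathrm{mod}\ 2)}\operatorname{rank}_{\mathbb{Z}G}(F_i)=\sum_{i\equiv 1\ (\mathrm{mod}\ 2)}\operatorname{rank}_{\mathbb{Z}G}(F_i),$$ and the trivial module $\mathbb{Z}$ has such a resolution $M_\bullet$ over $\mathbb{Z}\Gamma$, $2$-periodic in degrees $\ge n-1$, with $M_j\cong\mathbb{Z}\Gamma^{r}$ for all $j\ge n-1$.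
   Context: All modules are left modules; $\mathbb{Z}\Gamma$-modules are regarded as $\mathbb{Z}G$-modules via $G\to\Gamma$. A group $G$ is of type $\mathrm{FP}$ (respectively $\mathrm{FL}$) if the trivial $\mathbb{Z}G$-module $\mathbb{Z}$ has a finite length resolution by finitely generated projective (respectively free) $\mathbb{Z}G$-modules; $\operatorname{cd}(G)=\operatorname{pd}_{\mathbb{Z}G}(\mathbb{Z})$. A group $\Gamma$ is of type $\mathrm{VFP}$ if it has a torsion-free subgroup of finite index and every finite index torsion-free subgroup is of type $\mathrm{FP}$. A module is of type $\mathrm{FP}_\infty$ if it has a projective resolution by finitely generated projective modules; such a resolution is called finite type. A resolution $(M_j,\partial_j:M_j\to M_{j-1})_{j\ge 0}$ is $2$-periodic in degrees $\ge m$ if $M_{j+2}=M_j$ for all $j\ge m$ and $\partial_{j+2}=\partial_j$ for all $j\ge m+1$. The number $r$ is called the stable rank. *)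

(* Defs.v *)
From HB Require Import structures.
From mathcomp Require Import all_boot all_order all_algebra finmap.
From mathcomp Require Import monalg.

Set Implicit Arguments.
Unset Strict Implicit.
Unset Printing Implicit Defensive.

Import GRing.Theory.

Local Open Scope ring_scope.

(* Finitely supported functions G -> int; [x@_g] is the coefficient of g in x
   and [<< k *g g >>] is the element k.g. The library makes {malg int[K]} a
   ring only for monoids K without nontrivial units, hence the ring structure
   built here on a separate name. *)
Definition groupring (G : groupType) : Type := {malg int[G]}.

HB.instance Definition _ (G : groupType) :=
  GRing.Zmodule.copy (groupring G) {malg int[G]}.

Section Lift.
Variables (K : choiceType) (V : zmodType) (phi : K -> V).

Definition gr_lift (x : {malg int[K]}) : V := \sum_(k <- msupp x) phi k *~ x@_k.

Lemma gr_lift_sub (x : {malg int[K]}) (D : {fset K}) :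
  (msupp x `<=` D)%fset -> gr_lift x = \sum_(k <- D) phi k *~ x@_k.
Proof.
move=> sD; rewrite /gr_lift; apply: big_fset_incl => // k _ /mcoeff_outdom ->.
by rewrite mulr0z.
Qed.

Lemma gr_liftD : {morph gr_lift : x y / x + y}.
Proof.
move=> x y; rewrite (gr_lift_sub (msuppD_le x y)).
rewrite (gr_lift_sub (fsubsetUl (msupp x) (msupp y))).
rewrite (gr_lift_sub (fsubsetUr (msupp x) (msupp y))).
by rewrite -big_split; apply: eq_bigr => k _; rewrite mcoeffD mulrzDr.
Qed.

Lemma gr_lift0 : gr_lift 0 = 0.
Proof. by rewrite /gr_lift msupp0 big_seq_fset0. Qed.

Lemma gr_liftU k c : gr_lift << c *g k >> = phi k *~ c.
Proof.
by rewrite (gr_lift_sub msuppU_le) big_seq_fset1 mcoeffUU.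
Qed.

Lemma gr_lift_sum I (r : seq I) (F : I -> {malg int[K]}) :
  gr_lift (\sum_(i <- r) F i) = \sum_(i <- r) gr_lift (F i).
Proof. exact: (big_morph _ gr_liftD gr_lift0). Qed.

End Lift.

Lemma eq_gr_lift (K : choiceType) (V : zmodType) (phi psi : K -> V) x :
  phi =1 psi -> gr_lift phi x = gr_lift psi x.
Proof. by move=> e; apply: eq_bigr => k _; rewrite e. Qed.

Lemma gr_lift_unique (K : choiceType) (V : zmodType) (f : {malg int[K]} -> V) :
  {morph f : x y / x + y} -> f =1 gr_lift (fun k => f << k >>).
Proof.
move=> fD x; have f0 : f 0 = 0 by apply: (addIr (f 0)); rewrite -fD !add0r.
have fN y : f (- y) = - f y by apply: (addIr (f y)); rewrite -fD !addNr.
have fU k c : f << c *g k >> = f << k >> *~ c.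
  have fn m : f << m%:Z *g k >> = f << k >> *~ m%:Z.
    elim: m => [|m IH]; first by rewrite monalgU0 f0 mulr0z.
    by rewrite intS monalgUD fD IH mulrzDr mulr1z.
  case: (intP c) => [|m|m]; [exact: (fn 0%N) | exact: (fn m.+1) |].
  by rewrite monalgUN fN fn mulrNz.
rewrite [in LHS](monalgE x) (big_morph f fD f0) /gr_lift.
by apply: eq_bigr => k _; rewrite fU.
Qed.

Section GroupRing.
Variable G : groupType.
Implicit Types x y z : groupring G.

Definition gr_one : groupring G := << 1%g >>.

Definition gr_mul x y : groupring G :=
  \sum_(g <- msupp x) \sum_(h <- msupp y) << x@_g * y@_h *g (g * h)%g >>.

Let mul_lift x y :
  gr_mul x y = gr_lift (fun g => gr_lift (fun h => << (g * h)%g >>) y) x.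
Proof.
rewrite /gr_mul /gr_lift; apply: eq_bigr => g _.
rewrite mulrz_suml; apply: eq_bigr => h _.
by rewrite -mulrzA -[RHS](raddfMz (mkmalgU _)) /= mulrC intz.
Qed.

Let mulDl : left_distributive gr_mul +%R.
Proof. by move=> x y z; rewrite !mul_lift gr_liftD. Qed.

Let mulDr : right_distributive gr_mul +%R.
Proof.
move=> x y z; rewrite !mul_lift /gr_lift -big_split; apply: eq_bigr => g _ /=.
by rewrite -mulrzDl; congr (_ *~ _); apply: gr_liftD.
Qed.

Lemma gr_mulUU g h : gr_mul << g >> << h >> = << (g * h)%g >>.
Proof. by rewrite mul_lift !gr_liftU !mulr1z. Qed.

Let mulA : associative gr_mul.
Proof.
move=> x y z; rewrite (gr_lift_unique (f := fun x => gr_mul x (gr_mul y z)));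
  last by move=> u v; rewrite mulDl.
rewrite (gr_lift_unique (f := fun x => gr_mul (gr_mul x y) z));
  last by move=> u v; rewrite !mulDl.
apply: eq_gr_lift => g.
rewrite (gr_lift_unique (f := fun y => gr_mul << g >> (gr_mul y z)));
  last by move=> u v; rewrite mulDl mulDr.
rewrite (gr_lift_unique (f := fun y => gr_mul (gr_mul << g >> y) z));
  last by move=> u v; rewrite mulDr mulDl.
apply: eq_gr_lift => h.
rewrite (gr_lift_unique (f := fun z => gr_mul << g >> (gr_mul << h >> z)));
  last by move=> u v; rewrite !mulDr.
rewrite (gr_lift_unique (f := fun z => gr_mul (gr_mul << g >> << h >>) z));
  last by move=> u v; rewrite !mulDr.
by apply: eq_gr_lift => k; rewrite !gr_mulUU mulgA.
Qed.

Let mul1 : left_id gr_one gr_mul.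
Proof.
move=> x; rewrite (gr_lift_unique (f := fun x => gr_mul gr_one x));
  last by move=> u v; rewrite mulDr.
rewrite [RHS](gr_lift_unique (f := id)) //.
by apply: eq_gr_lift => g; rewrite gr_mulUU mul1g.
Qed.

Let mulr1 : right_id gr_one gr_mul.
Proof.
move=> x; rewrite (gr_lift_unique (f := fun x => gr_mul x gr_one));
  last by move=> u v; rewrite mulDl.
rewrite [RHS](gr_lift_unique (f := id)) //.
by apply: eq_gr_lift => g; rewrite gr_mulUU mulg1.
Qed.

Let one_neq0 : gr_one != 0.
Proof. by rewrite monalgU_eq0. Qed.

HB.instance Definition _ := GRing.Zmodule_isNzRing.Build (groupring G)
  mulA mul1 mulr1 mulDl mulDr one_neq0.

End GroupRing.

Section Morphisms.
Variables (G H : groupType) (f : {multiplicative G -> H}).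

Definition gr_map (x : groupring G) : groupring H :=
  \sum_(g <- msupp x) << x@_g *g f g >>.

Let mapE : gr_map =1 gr_lift (fun g => << f g >>).
Proof.
move=> x; apply: eq_bigr => g _.
by rewrite -[RHS](raddfMz (mkmalgU _)) /= intz.
Qed.

Lemma gr_map_is_additive : {morph gr_map : x y / x + y}.
Proof. by move=> x y; rewrite !mapE gr_liftD. Qed.

Lemma gr_mapU g : gr_map << g >> = << f g >>.
Proof. by rewrite mapE gr_liftU mulr1z. Qed.

Lemma gr_map_is_monoid_morphism : GRing.monoid_morphism gr_map.
Proof.
have f1 : f 1%g = 1%g by apply: (mulgI (f 1%g)); rewrite -gmulfM !mulg1.
split=> [|x y]; first by rewrite [LHS]gr_mapU f1.
rewrite (gr_lift_unique (f := fun x : groupring G => gr_map (x * y)));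
  last by move=> u v; rewrite mulrDl gr_map_is_additive.
rewrite (gr_lift_unique (f := fun x : groupring G => gr_map x * gr_map y));
  last by move=> u v; rewrite gr_map_is_additive mulrDl.
apply: eq_gr_lift => g.
rewrite (gr_lift_unique (f := fun y : groupring G => gr_map ((<< g >> : groupring G) * y)));
  last by move=> u v; rewrite mulrDr gr_map_is_additive.
rewrite (gr_lift_unique (f := fun y : groupring G => gr_map << g >> * gr_map y));
  last by move=> u v; rewrite gr_map_is_additive mulrDr.
apply: eq_gr_lift => h; rewrite -[X in gr_map X]/(gr_mul _ _).
by rewrite gr_mulUU !gr_mapU gmulfM -gr_mulUU.
Qed.

HB.instance Definition _ := GRing.isNmodMorphism.Build _ _ gr_map
  (conj (etrans (mapE 0) (gr_lift0 _)) gr_map_is_additive).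
HB.instance Definition _ :=
  GRing.isMonoidMorphism.Build _ _ gr_map gr_map_is_monoid_morphism.

End Morphisms.

Section Augmentation.
Variable G : groupType.

Definition gr_aug (x : groupring G) : int := \sum_(g <- msupp x) x@_g.

Let augE : gr_aug =1 gr_lift (fun=> 1).
Proof. by move=> x; apply: eq_bigr => g _; rewrite intz. Qed.

Lemma gr_aug_is_additive : {morph gr_aug : x y / x + y}.
Proof. by move=> x y; rewrite !augE gr_liftD. Qed.

Lemma gr_augU g : gr_aug << g >> = 1.
Proof. by rewrite augE gr_liftU mulr1z. Qed.

Lemma gr_aug_is_monoid_morphism : GRing.monoid_morphism gr_aug.
Proof.
split=> [|x y]; first exact: gr_augU.
rewrite (gr_lift_unique (f := fun x : groupring G => gr_aug (x * y)));
  last by move=> u v; rewrite mulrDl gr_aug_is_additive.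
rewrite (gr_lift_unique (f := fun x : groupring G => gr_aug x * gr_aug y));
  last by move=> u v; rewrite gr_aug_is_additive mulrDl.
apply: eq_gr_lift => g.
rewrite (gr_lift_unique (f := fun y : groupring G => gr_aug ((<< g >> : groupring G) * y)));
  last by move=> u v; rewrite mulrDr gr_aug_is_additive.
rewrite (gr_lift_unique (f := fun y : groupring G => gr_aug << g >> * gr_aug y));
  last by move=> u v; rewrite gr_aug_is_additive mulrDr.
apply: eq_gr_lift => h; rewrite -[X in gr_aug X]/(gr_mul _ _).
by rewrite gr_mulUU !gr_augU.
Qed.

HB.instance Definition _ := GRing.isNmodMorphism.Build _ _ gr_aug
  (conj (etrans (augE 0) (gr_lift0 _)) gr_aug_is_additive).
HB.instance Definition _ :=
  GRing.isMonoidMorphism.Build _ _ gr_aug gr_aug_is_monoid_morphism.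

End Augmentation.

(* f is a phantom argument: it selects the action a . v = f a *: v of R on the
   carrier of N. *)
Definition restrict (R S : pzRingType) (f : {rmorphism R -> S})
  (N : lmodType S) : Type := N.

Section Restriction.
Variables (R S : pzRingType) (f : {rmorphism R -> S}) (N : lmodType S).
Local Notation restrict := (restrict f N).

HB.instance Definition _ := GRing.Zmodule.copy restrict N.

Definition restrict_scale (a : R) (v : restrict) : restrict := f a *: (v : N).

Let scaleA a b v :
  restrict_scale a (restrict_scale b v) = restrict_scale (a * b) v.
Proof. by rewrite /restrict_scale rmorphM -scalerA. Qed.

Let scale1 : left_id 1 restrict_scale.
Proof. by move=> v; rewrite /restrict_scale rmorph1 scale1r. Qed.

Let scaleDr : right_distributive restrict_scale +%R.
Proof. by move=> a u v; rewrite /restrict_scale scalerDr. Qed.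

Let scaleDl v : {morph restrict_scale^~ v : a b / a + b}.
Proof. by move=> a b; rewrite /restrict_scale rmorphD scalerDl. Qed.

HB.instance Definition _ :=
  GRing.Zmodule_isLmodule.Build R restrict scaleA scale1 scaleDr scaleDl.

End Restriction.

Definition trivial_mod (G : groupType) : lmodType (groupring G) :=
  restrict (@gr_aug G) int^o.

Section Modules.
Variable R : pzRingType.
Implicit Types M N P : lmodType R.

Definition projective P : Prop :=
  forall (A B : lmodType R) (p : {linear A -> B}) (h : {linear P -> B}),
    (forall b, exists a, p a = b) ->
    exists k : {linear P -> A}, forall x, p (k x) = h x.

Definition finitely_generated M : Prop :=
  exists (k : nat) (e : 'I_k -> M),
    forall x, exists a : 'I_k -> R, x = \sum_i a i *: e i.

Definition free_of_rank M (r : nat) : Prop :=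
  exists f : {linear 'rV[R]_r -> M}, bijective f.

Definition trivial_module M : Prop := forall x : M, x = 0.

(* [res_d j] is the differential from degree j.+1 to degree j *)
Record resolution N := Resolution {
  res_mod :> nat -> lmodType R;
  res_d : forall j, {linear res_mod j.+1 -> res_mod j};
  res_aug : {linear res_mod 0%N -> N};
  res_aug_surj : forall y, exists x, res_aug x = y;
  res_exact0 : forall x, res_aug x = 0 <-> exists y, res_d 0 y = x;
  res_exactS : forall j x, res_d j x = 0 <-> exists y, res_d j.+1 y = x
}.

(* The degree n term itself may vanish: "length n" is "length at most n" *)
Definition res_length N (M : resolution N) (n : nat) : Prop :=
  forall j, (n < j)%N -> trivial_module (M j).

Definition projective_resolution N (M : resolution N) : Prop :=
  forall j, projective (M j).

Definition finite_type_projective_resolution N (M : resolution N) : Prop :=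
  forall j, projective (M j) /\ finitely_generated (M j).

Definition has_pd_le N (n : nat) : Prop :=
  exists M : resolution N, projective_resolution M /\ res_length M n.

(* pd N = n; in particular pd N is finite. The zero module gets pd 0. *)
Definition has_pd N (n : nat) : Prop :=
  has_pd_le N n /\ forall m, has_pd_le N m -> (n <= m)%N.

Definition type_FPinf N : Prop :=
  exists M : resolution N, finite_type_projective_resolution M.

(* A linear map bundled with its source and target, so that differentials in
   different degrees can be compared by equality *)
Record arrow := Arrow {
  arrow_src : lmodType R;
  arrow_tgt : lmodType R;
  arrow_map : {linear arrow_src -> arrow_tgt}
}.

Definition two_periodic N (M : resolution N) (m : nat) : Prop :=
  (forall j, (m <= j)%N -> M j.+2 = M j) /\
  (forall j, (m <= j)%N -> Arrow (res_d M j.+2) = Arrow (res_d M j)).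

End Modules.

Definition type_FP (G : groupType) : Prop :=
  exists (M : resolution (trivial_mod G)) (n : nat),
    finite_type_projective_resolution M /\ res_length M n.

Definition type_FL (G : groupType) : Prop :=
  exists (M : resolution (trivial_mod G)) (n : nat),
    (forall j, exists r, free_of_rank (M j) r) /\ res_length M n.

Definition has_cd (G : groupType) (n : nat) : Prop := has_pd (trivial_mod G) n.

Definition subgroup_of (G : groupType) (S : groupClosed G) : Type :=
  {g : G | g \in S}.

Section Subgroup.
Variables (G : groupType) (S : groupClosed G).

HB.instance Definition _ := SubChoice.copy (subgroup_of S) {g : G | g \in S}.

Let subgroup_closed : group_closed (fun g : G => g \in S).
Proof. by split=> [|g h]; [exact: gpred1 | exact: gpredF]. Qed.

HB.instance Definition _ :=
  SubChoice_isSubGroup.Build G (fun g => g \in S) (subgroup_of S)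
    subgroup_closed.

End Subgroup.

Definition finite_index (G : groupType) (S : groupClosed G) : Prop :=
  exists s : seq G, forall g, exists2 t, t \in s & (t^-1 * g)%g \in S.

Definition torsion_free (G : groupType) : Prop :=
  forall (g : G) (n : nat), (0 < n)%N -> (g ^+ n)%g = 1%g -> g = 1%g.

Definition type_VFP (G : groupType) : Prop :=
  (exists2 S : groupClosed G, finite_index S & torsion_free (subgroup_of S)) /\
  (forall S : groupClosed G,
     finite_index S -> torsion_free (subgroup_of S) -> type_FP (subgroup_of S)).

Definition central (G : groupType) (c : G) : Prop :=
  forall g : G, commute c g.

(* pi exhibits Q as the quotient of G by the cyclic subgroup <c> *)
Definition quotient_by_cycle (G Q : groupType) (pi : {multiplicative G -> Q})
    (c : G) : Prop :=
  (forall q, exists g, pi g = q) /\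
  (forall g, pi g = 1%g <-> exists k : nat, g = (c ^+ k)%g \/ g = (c ^- k)%g).

(* Main.v *)
(* Put w = c - 1. Since G has type FP, the central element c has infinite order
   (Tate cohomology of a finite central subgroup would not vanish on Z), so w is
   a central non-zero-divisor of ZG and ZQ = ZG / w. If N is a ZQ-module with a
   resolution 0 -> P1 -> P0 -> N over ZG, then w : P0 -> P0 factors through P1,
   and the resulting matrix factorization of w reduces modulo w to a 2-periodic
   ZQ-resolution of N. In general, map a module M0, free over ZQ, onto N: a
   mapping cone shows that the projective dimension over ZG of the kernel is
   smaller than that of N, and induction applies. When N = Z and M0 = F0 / w, the
   cone is free of ranks rk F1, rk F2 + rk F0, rk F3, ..., which gives the stable
   rank. The alternating sum of the ranks vanishes because w is null-homotopic on
   F and has trace -rk F_i on F_i, the trace being read off at the coefficient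
   of 1. *)
Require Import Defs.
From HB Require Import structures.
From mathcomp Require Import all_boot all_order all_algebra finmap.
From mathcomp Require Import monalg ring.

Set Implicit Arguments.
Unset Strict Implicit.
Unset Printing Implicit Defensive.

Import GRing.Theory.

Local Open Scope ring_scope.

(** * Linear maps: kernels and factorizations *)

Definition mklin (R : pzRingType) (M N : lmodType R) (f : M -> N)
    (fl : linear f) : {linear M -> N} :=
  HB.pack f (GRing.isLinear.Build R M N *:%R f fl).

Section Kernel.
Variables (R : pzRingType) (M N : lmodType R) (f : {linear M -> N}).

Definition kernel_pred : {pred M} := fun x => f x == 0.

Definition kernel : Type := {x : M | x \in kernel_pred}.

HB.instance Definition _ := SubChoice.copy kernel {x : M | x \in kernel_pred}.

Let kernel_closed : subsemimod_closed kernel_pred.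
Proof.
have mem x : (x \in kernel_pred) = (f x == 0) by [].
split=> [|a x]; last by rewrite !mem linearZ_LR => /eqP ->; rewrite scaler0.
split=> [|x y]; rewrite !mem ?linear0 ?eqxx // linearD.
by move=> /eqP -> /eqP ->; rewrite addr0.
Qed.

HB.instance Definition _ :=
  GRing.SubChoice_isSubLmodule.Build R M kernel_pred kernel kernel_closed.

Definition kernel_val : {linear kernel -> M} := (val : kernel -> M).

Lemma kernel_val_inj : injective kernel_val.
Proof. exact: val_inj. Qed.

Lemma kernelP (x : kernel) : f (kernel_val x) = 0.
Proof. exact: (eqP (valP x)). Qed.

Lemma kernel_lift (x : M) : f x = 0 -> exists y : kernel, kernel_val y = x.
Proof.
move=> fx; have xk : x \in kernel_pred by apply/eqP.
by exists (Sub x xk); apply: SubK.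
Qed.

End Kernel.

Section Factorization.
Variables (R : pzRingType) (P A B : lmodType R).
Variables (p : {linear P -> A}) (f : {linear P -> B}).
Hypothesis p_surj : forall y, exists x, p x = y.

Lemma linear_descend :
  (forall x, p x = 0 -> f x = 0) ->
  exists g : {linear A -> B}, forall x, g (p x) = f x.
Proof.
move=> pf.
have ex y : exists x, p x == y by have [x <-] := p_surj y; exists x.
pose g y := f (xchoose (ex y)).
have gE x : g (p x) = f x.
  apply/eqP; rewrite -subr_eq0 -linearB; apply/eqP/pf.
  by rewrite linearB (eqP (xchooseP (ex (p x)))) subrr.
have gl : linear g.
  move=> a u v; have [x <-] := p_surj u; have [y <-] := p_surj v.
  by rewrite -linearP !gE linearP.
by exists (mklin gl).
Qed.

End Factorization.

Lemma linear_factor (R : pzRingType) (X K M : lmodType R)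
    (k : {linear K -> M}) (f : {linear X -> M}) :
  injective k -> (forall x, exists y, k y = f x) ->
  exists g : {linear X -> K}, forall x, k (g x) = f x.
Proof.
move=> kI kf.
have ex x : exists y, k y == f x by have [y <-] := kf x; exists y.
pose g x := xchoose (ex x); have gE x : k (g x) = f x := eqP (xchooseP (ex x)).
have gl : linear g by move=> a u v; apply: kI; rewrite linearP !gE linearP.
by exists (mklin gl).
Qed.

(** * Projective, finitely generated and free modules *)

Section ProjectiveTheory.
Variable R : pzRingType.
Implicit Types A B M N P : lmodType R.

(* The lift is a section of the projection from the pullback of u and v. *)
Lemma projective_lift P A B (u : {linear P -> B}) (v : {linear A -> B}) :
  projective P -> (forall x, exists y, v y = u x) ->
  exists k : {linear P -> A}, forall x, v (k x) = u x.
Proof.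
move=> prP uv.
have fl : linear (fun z : A * P => v z.1 - u z.2).
  by move=> a z t /=; rewrite !linearP /= scalerDr addrACA.
have sl : linear (fun z : A * P => z.2) by [].
have tl : linear (fun z : A * P => z.1) by [].
have [z|k kE] := prP _ _ (mklin sl \o kernel_val (mklin fl))%FUN idfun.
  have [y yE] := uv z.
  have [//|t tE] := @kernel_lift _ _ _ (mklin fl) (y, z).
    by rewrite /= yE subrr.
  by exists t; apply: (congr1 snd tE).
exists (mklin tl \o kernel_val (mklin fl) \o k)%FUN => x.
move: (kE x) (kernelP (k x)) => /= -> /eqP.
by rewrite subr_eq0 => /eqP.
Qed.

Lemma projective_retract P A (i : {linear P -> A}) (r : {linear A -> P}) :
  cancel i r -> projective A -> projective P.
Proof.
move=> ri prA X B p h pS.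
have [k kE] := prA _ _ p (h \o r)%FUN pS.
by exists (k \o i)%FUN => x; rewrite /= kE /= ri.
Qed.

Lemma finitely_generated_quotient A B (p : {linear A -> B}) :
  (forall y, exists x, p x = y) -> finitely_generated A -> finitely_generated B.
Proof.
move=> pS [k [e eP]]; exists k, (fun i => p (e i)) => y.
have [x <-] := pS y; have [a ->] := eP x; exists a.
by rewrite linear_sum; apply: eq_bigr => i _; rewrite linearZ_LR.
Qed.

Lemma projective_prod A B : projective A -> projective B -> projective (A * B)%type.
Proof.
move=> prA prB X Y p h pS.
have il : linear (fun x : A => (x, 0) : A * B).
  by move=> a x y; congr pair; rewrite /= scaler0 addr0.
have jl : linear (fun x : B => (0, x) : A * B).
  by move=> a x y; congr pair; rewrite /= scaler0 addr0.
have [k kE] := prA _ _ p (h \o mklin il)%FUN pS.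
have [l lE] := prB _ _ p (h \o mklin jl)%FUN pS.
have ml : linear (fun z : A * B => k z.1 + l z.2).
  by move=> a x y /=; rewrite !linearP scalerDr addrACA.
exists (mklin ml) => -[x y] /=; rewrite linearD kE lE /= -linearD.
by congr (h _); congr pair; rewrite /= ?addr0 ?add0r.
Qed.

Lemma projective_surj_section P A (p : {linear A -> P}) :
  projective P -> (forall y, exists x, p x = y) ->
  exists s : {linear P -> A}, cancel s p.
Proof. by move=> prP pS; have [s sE] := prP _ _ p idfun pS; exists s. Qed.

Lemma split_kernel_retract A P (p : {linear A -> P}) (s : {linear P -> A}) :
  cancel s p ->
  exists r : {linear A -> kernel p}, cancel (kernel_val p) r.
Proof.
move=> sK.
have fl : linear (fun x => x - s (p x)).
  by move=> a x y; rewrite !linearP /= scalerDr addrACA.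
have [x|r rE] := linear_factor (f := mklin fl) (@kernel_val_inj _ _ _ p).
  by apply: kernel_lift; rewrite /= linearB sK subrr.
exists r => x; apply: (@kernel_val_inj _ _ _ p).
by rewrite rE /= (kernelP x) linear0 subr0.
Qed.

(** A surjection onto a projective module splits, so its kernel is a direct summand of the
    source. *)
Lemma projective_kernel A P (p : {linear A -> P}) :
  (forall y, exists x, p x = y) -> projective A -> projective P ->
  projective (kernel p).
Proof.
move=> pS prA prP; have [s sK] := projective_surj_section prP pS.
by have [r rK] := split_kernel_retract sK; apply: projective_retract rK prA.
Qed.

Lemma finitely_generated_kernel A P (p : {linear A -> P}) :
  (forall y, exists x, p x = y) -> projective P -> finitely_generated A ->
  finitely_generated (kernel p).
Proof.
move=> pS prP fgA; have [s sK] := projective_surj_section prP pS.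
have [r rK] := split_kernel_retract sK.
by apply: (finitely_generated_quotient (p := r)) fgA => y; exists (kernel_val p y).
Qed.

Lemma finitely_generatedP M :
  finitely_generated M <->
  exists k (p : {linear 'rV[R]_k -> M}), forall y, exists x, p x = y.
Proof.
split=> [[k [e eP]]|[k [p pS]]].
  have fl : linear (fun x : 'rV[R]_k => \sum_i x 0 i *: e i).
    move=> a x y; rewrite scaler_sumr -big_split; apply: eq_bigr => i _ /=.
    by rewrite !mxE scalerDl scalerA.
  exists k, (mklin fl) => y; have [a ->] := eP y; exists (\row_i a i).
  by apply: eq_bigr => i _; rewrite mxE.
apply: finitely_generated_quotient pS _; exists k, (fun i => delta_mx 0 i) => x.
by exists (x 0); apply: row_sum_delta.
Qed.

Lemma projective_row r : projective 'rV[R]_r.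
Proof.
move=> A B p h pS.
have ex i : exists a, p a == h (delta_mx 0 i).
  by have [a <-] := pS (h (delta_mx 0 i)); exists a.
have fl : linear (fun x : 'rV[R]_r => \sum_i x 0 i *: xchoose (ex i)).
  move=> a x y; rewrite scaler_sumr -big_split; apply: eq_bigr => i _ /=.
  by rewrite !mxE scalerDl scalerA.
exists (mklin fl) => x /=; rewrite [in RHS](row_sum_delta x) !linear_sum.
by apply: eq_bigr => i _; rewrite !linearZ_LR (eqP (xchooseP (ex i))).
Qed.

Lemma finitely_generated_row r : finitely_generated 'rV[R]_r.
Proof. by apply/finitely_generatedP; exists r, idfun => y; exists y. Qed.

Lemma finitely_generated_prod A B :
  finitely_generated A -> finitely_generated B -> finitely_generated (A * B)%type.
Proof.
move=> /finitely_generatedP[k [p pS]] /finitely_generatedP[l [q qS]].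
have fl : linear (fun x : 'rV[R]_(k + l) => (p (lsubmx x), q (rsubmx x))).
  by move=> a x y; congr pair; rewrite /= !linearP.
apply/finitely_generatedP; exists (k + l)%N, (mklin fl) => -[a b].
have [x <-] := pS a; have [y <-] := qS b.
by exists (row_mx x y); rewrite /= row_mxKl row_mxKr.
Qed.

Lemma free_of_rank_iso A B r (f : {linear A -> B}) :
  bijective f -> free_of_rank A r -> free_of_rank B r.
Proof. by move=> bf [g bg]; exists (f \o g)%FUN; apply: bij_comp. Qed.

Lemma linear_bij_inv A B (f : {linear A -> B}) : bijective f ->
  exists2 g : {linear B -> A}, cancel f g & cancel g f.
Proof.
move=> [g fK gK].
have gl : linear g by move=> a x y; rewrite -{1}[x]gK -{1}[y]gK -linearP fK.
by exists (mklin gl).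
Qed.

Lemma free_of_rank_prod A B r s :
  free_of_rank A r -> free_of_rank B s -> free_of_rank (A * B)%type (r + s).
Proof.
move=> [f [f' fK f'K]] [g [g' gK g'K]].
have hl : linear (fun x : 'rV[R]_(r + s) => (f (lsubmx x), g (rsubmx x))).
  by move=> a x y; congr pair; rewrite /= !linearP.
exists (mklin hl); exists (fun z : A * B => row_mx (f' z.1) (g' z.2)) => x /=.
  by rewrite fK gK hsubmxK.
by rewrite row_mxKl row_mxKr f'K g'K; case: x.
Qed.

Lemma free_of_rank_projective A r : free_of_rank A r -> projective A.
Proof.
move=> [f /linear_bij_inv[g fK gK]].
exact: projective_retract gK (@projective_row r).
Qed.

Lemma free_of_rank_finitely_generated A r : free_of_rank A r -> finitely_generated A.
Proof.
move=> [f [g fK gK]]; apply/finitely_generatedP; exists r, f => y.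
by exists (g y).
Qed.

End ProjectiveTheory.

(** * Splicing of resolutions and mapping cones *)

Section Splice.
Variables (R : pzRingType) (N K M0 : lmodType R).
Variables (k : {linear K -> M0}) (g : {linear M0 -> N}).
Hypotheses (k_inj : injective k) (g_surj : forall y, exists x, g x = y).
Hypothesis kg_exact : forall x, g x = 0 <-> exists y, k y = x.
Variable M : resolution K.

Definition splice_mod j : lmodType R := if j is i.+1 then M i else M0.

Definition splice_d j : {linear splice_mod j.+1 -> splice_mod j} :=
  match j with
  | 0 => (k \o res_aug M)%FUN
  | i.+1 => res_d M i
  end.

Let exact0 (x : splice_mod 0) : g x = 0 <-> exists y, splice_d 0 y = x.
Proof.
rewrite kg_exact; split=> [[y <-]|[y <-]]; last by exists (res_aug M y).
by have [z <-] := res_aug_surj M y; exists z.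
Qed.

Let exactS j x : splice_d j x = 0 <-> exists y, splice_d j.+1 y = x.
Proof.
case: j x => [|j] x; last exact: res_exactS.
rewrite -res_exact0; split=> /= [kx|->]; last exact: linear0.
by apply: k_inj; rewrite kx linear0.
Qed.

Definition splice : resolution N :=
  @Resolution R N splice_mod splice_d g g_surj exact0 exactS.

(** Splicing shifts degrees by one, so each inductive step on the projective dimension delays the
    period by one degree. *)
Lemma splice_two_periodic m : two_periodic M m -> two_periodic splice m.+1.
Proof. by move=> [P1 P2]; split=> -[|j] //= mj; [apply: P1 | apply: P2]. Qed.

End Splice.

Lemma res_dd (R : pzRingType) (N : lmodType R) (F : resolution N) j x :
  res_d F j (res_d F j.+1 x) = 0.
Proof. by apply/res_exactS; exists x. Qed.

Lemma res_aug_d (R : pzRingType) (N : lmodType R) (F : resolution N) x :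
  res_aug F (res_d F 0 x) = 0.
Proof. by apply/res_exact0; exists x. Qed.

Section Cone.
Variables (R : pzRingType) (N K M0 L0 L1 : lmodType R) (F : resolution N).
Variables (k : {linear K -> M0}) (g : {linear M0 -> N}).
Hypotheses (k_inj : injective k) (g_surj : forall y, exists x, g x = y).
Hypothesis kg_exact : forall x, g x = 0 <-> exists y, k y = x.
Variables (i : {linear L1 -> L0}) (p : {linear L0 -> M0}).
Hypotheses (i_inj : injective i) (p_surj : forall y, exists x, p x = y).
Hypothesis ip_exact : forall x, p x = 0 <-> exists y, i y = x.
Variables (h : {linear L0 -> F 0%N}) (t : {linear L1 -> F 1%N}).
Hypothesis hE : forall x, res_aug F (h x) = g (p x).
Hypothesis tE : forall x, res_d F 0 (t x) = h (i x).

Let bottom_linear : linear (fun z : F 1%N * L0 => res_d F 0 z.1 + h z.2).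
Proof. by move=> a x y; rewrite /= !linearP /= scalerDr addrACA. Qed.

Definition cone_bottom : {linear (F 1%N * L0)%type -> F 0%N} := mklin bottom_linear.

Lemma cone_bottom_surj y : exists x, cone_bottom x = y.
Proof.
have [m mE] := g_surj (res_aug F y); have [l lE] := p_surj m.
have [|x xE] := proj1 (res_exact0 (r := F) (y - h l)).
  by rewrite linearB /= hE lE mE subrr.
by exists (x, l); rewrite /= xE subrK.
Qed.

Let aug_linear :
  linear (fun x : kernel cone_bottom => p (kernel_val cone_bottom x).2).
Proof. by move=> a x y; rewrite /= !linearP. Qed.

(** On a cycle [(x, y)], applying [res_aug F] to [res_d F 0 x + h y = 0] gives [g (p y) = 0], so
    [p y] lies in the image of [K]. *)
Let aug_factor : exists f : {linear kernel cone_bottom -> K},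
  forall x, k (f x) = p (kernel_val cone_bottom x).2.
Proof.
apply: (linear_factor (f := mklin aug_linear)) => // x; apply/kg_exact => /=.
rewrite -hE; move: (kernelP x) => /= /(congr1 (res_aug F)).
by rewrite linearD res_aug_d add0r linear0.
Qed.

(** With the minus sign at [t], the two contributions [h (i z.2)] cancel under [cone_bottom]. *)
Let d0_linear :
  linear (fun z : F 2%N * L1 => (res_d F 1 z.1 - t z.2, i z.2) : (F 1%N * L0)%type).
Proof. by move=> a x y; congr pair; rewrite /= !linearP //= scalerDr addrACA. Qed.

Let d0_factor : exists f : {linear (F 2%N * L1)%type -> kernel cone_bottom},
  forall z, kernel_val cone_bottom (f z) = (res_d F 1 z.1 - t z.2, i z.2).
Proof.
apply: (linear_factor (f := mklin d0_linear)); first exact: kernel_val_inj.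
move=> z; apply: kernel_lift.
by rewrite /= linearB /= res_dd sub0r tE addNr.
Qed.

Let d1_linear : linear (fun z : F 3%N => (res_d F 2 z, 0) : (F 2%N * L1)%type).
Proof. by move=> a x y; congr pair; rewrite /= ?linearP // scaler0 addr0. Qed.

(** The cone of the chain map [(h, t)] over [g] has terms [F 0], [F 1 * L0], [F 2 * L1], [F 3], ...,
    and its only homology is [K], in degree 1. Its lowest differential is onto, so the complex is
    truncated to the kernel of that map and shifted down by one degree. *)
Definition cone_mod j : lmodType R :=
  match j with
  | 0 => kernel cone_bottom
  | 1 => (F 2%N * L1)%type
  | i.+2 => F i.+3
  end.

Lemma cone_resolution : exists E : resolution K, res_mod E = cone_mod.
Proof.
have [aug augE] := aug_factor; have [d0 d0E] := d0_factor.
pose d j : {linear cone_mod j.+1 -> cone_mod j} :=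
  match j with
  | 0 => d0
  | 1 => mklin d1_linear
  | i.+2 => res_d F i.+3
  end.
have aug_surj y : exists x, aug x = y.
  have [l lE] := p_surj (k y).
  have [|x xE] := proj1 (res_exact0 (r := F) (- h l)).
    by rewrite linearN hE lE (proj2 (kg_exact _)) ?oppr0 //; exists y.
  have [|z zE] := kernel_lift (f := cone_bottom) (x := (x, l)).
    by rewrite /= xE addNr.
  by exists z; apply: k_inj; rewrite augE zE.
have ex0 (x : cone_mod 0) : aug x = 0 <-> exists y, d 0%N y = x.
  split=> [ax|[y <-]]; last first.
    apply: k_inj; rewrite augE -[d 0%N y]/(d0 y) d0E linear0.
    by apply/ip_exact; exists y.2.
  have [|l lE] := proj1 (ip_exact (kernel_val cone_bottom x).2).
    by rewrite -augE ax linear0.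
  have xE := kernelP x.
  have [|y yE] := proj1 (res_exactS (r := F) (j := 0)
      ((kernel_val cone_bottom x).1 + t l)).
    by rewrite linearD /= tE lE.
  exists (y, l); apply: kernel_val_inj; rewrite d0E /= yE addrK lE.
  by rewrite -surjective_pairing.
have exS j x : d j x = 0 <-> exists y, d j.+1 y = x.
  case: j x => [|[|j]] x; last exact: res_exactS.
    split=> [dx|[y <-]]; last first.
      apply: kernel_val_inj; rewrite d0E /= res_dd linear0 subr0.
      by rewrite !linear0.
    move: (d0E x); rewrite [d0 x]dx linear0 => -[e1 e2].
    have x20 : x.2 = 0 by apply: i_inj; rewrite -e2 linear0.
    move: e1; rewrite x20 linear0 subr0 => /esym/res_exactS[y yE].
    by exists y; rewrite /= yE -x20; case: x {dx e2 x20 yE}.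
  rewrite -res_exactS /=; split=> [[]//|->] //.
by exists (@Resolution R K cone_mod d aug aug_surj ex0 exS).
Qed.

End Cone.

Lemma trivial_row0 (R : pzRingType) : trivial_module 'rV[R]_0.
Proof. by move=> x; apply/rowP => -[]. Qed.

Section KernelOfCover.
Variables (R : pzRingType) (N M0 : lmodType R) (g : {linear M0 -> N}).
Hypotheses (g_surj : forall y, exists x, g x = y) (prM0 : projective M0).

Lemma kernel_val_exact x : g x = 0 <-> exists y, kernel_val g y = x.
Proof. by split=> [/kernel_lift //|[y <-]]; apply: kernelP. Qed.

(** For projective [M0] the cone is taken with [L0 = M0] and [L1 = 0]. The zero module appears as
    rows of length 0, whence the extra factor in degree 1. *)
Lemma kernel_resolution (F : resolution N) :
  exists (B : {linear (F 1%N * M0)%type -> F 0%N}) (E : resolution (kernel g)),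
    (forall y, exists x, B x = y) /\
    res_mod E = fun j => match j with
                | 0 => kernel B
                | 1 => (F 2%N * 'rV[R]_0)%type
                | i.+2 => F i.+3
                end.
Proof.
have [x|h hE] := projective_lift (u := g) (v := res_aug F) prM0.
  exact: res_aug_surj.
have zl (M : lmodType R) : linear (fun _ : 'rV[R]_0 => 0 : M).
  by move=> a x y; rewrite scaler0 addr0.
have zi : injective (mklin (zl M0)).
  by move=> x y _; rewrite (trivial_row0 x) (trivial_row0 y).
have ze x : idfun x = 0 <-> exists y, mklin (zl M0) y = x.
  by split=> /= [->|[y <-] //]; exists 0.
have idS (y : M0) : exists x, idfun x = y by exists y.
have [||E EE] := cone_resolution (F := F) (@kernel_val_inj _ _ _ g)
  kernel_val_exact (i := mklin (zl M0)) (p := idfun) zi idS ze (h := h)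
  (t := mklin (zl _)) => // [x|]; first by rewrite /= !linear0.
exists (cone_bottom h), E; split=> //.
by apply: (cone_bottom_surj g_surj (p := idfun)).
Qed.

End KernelOfCover.

(** * Finiteness conditions on kernels of projective covers *)

Section FinitenessConditions.
Variable R : pzRingType.
Implicit Types A B C M N : lmodType R.

Lemma finitely_generated_extension A B C (i : {linear A -> B}) (p : {linear B -> C}) :
  (forall x, p x = 0 -> exists y, i y = x) -> (forall y, exists x, p x = y) ->
  finitely_generated A -> finitely_generated C -> finitely_generated B.
Proof.
move=> ip pS fgA /finitely_generatedP[k [f fS]].
have [x|l lE] := projective_lift (u := f) (v := p) (@projective_row R k).
  exact: pS.
have ml : linear (fun z : (A * 'rV[R]_k)%type => i z.1 + l z.2).
  by move=> a x y; rewrite /= !linearP /= scalerDr addrACA.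
apply: (finitely_generated_quotient (p := mklin ml)); last first.
  exact: finitely_generated_prod fgA (@finitely_generated_row R k).
move=> b; have [u uE] := fS (p b).
have [|y yE] := ip (b - l u); first by rewrite linearB /= lE uE subrr.
by exists (y, u); rewrite /= yE subrK.
Qed.

Lemma type_FPinf_finitely_generated N : type_FPinf N -> finitely_generated N.
Proof.
move=> [M fM]; apply: finitely_generated_quotient (proj2 (fM 0)).
exact: res_aug_surj.
Qed.

(** In the cone resolution of the kernel, the degree 0 term is a summand of [F 1 * M], because the
    map onto the projective [F 0] splits. *)
Lemma type_FPinf_kernel M N (g : {linear M -> N}) :
  (forall y, exists x, g x = y) -> projective M -> finitely_generated M ->
  type_FPinf N -> type_FPinf (kernel g).
Proof.
move=> gS prM fgM [F fF].
have [B [E [BS EE]]] := kernel_resolution gS prM F.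
have prF j : projective (F j) by case: (fF j).
have fgF j : finitely_generated (F j) by case: (fF j).
exists E => j; rewrite EE; case: j => [|[|j]] //; split.
- by apply: projective_kernel => //; apply: projective_prod.
- by apply: finitely_generated_kernel => //; apply: finitely_generated_prod.
- by apply: projective_prod => //; apply: projective_row.
- by apply: finitely_generated_prod => //; apply: finitely_generated_row.
Qed.

(** If [F] has length 1, the cone resolution of the kernel vanishes in degree 1, so its augmentation
    is an isomorphism from a projective module. *)
Lemma pd_le1_projective_kernel M N (g : {linear M -> N}) :
  (forall y, exists x, g x = y) -> projective M ->
  has_pd_le N 1 -> projective (kernel g).
Proof.
move=> gS prM [F [prF lF]].
have [B [E [BS EE]]] := kernel_resolution gS prM F.
have prE : projective (E 0%N).
  by rewrite EE; apply: projective_kernel => //; apply: projective_prod.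
have trE : trivial_module (E 1%N).
  by rewrite EE => -[x y]; rewrite (lF 2%N isT x) (trivial_row0 y).
have augI : injective (res_aug E).
  move=> x y xy; apply/eqP; rewrite -subr_eq0; apply/eqP.
  have [|z <-] := proj1 (res_exact0 (r := E) (x - y)).
    by rewrite linearB xy subrr.
  by rewrite (trE z) linear0.
have [x|s sE] := linear_factor (f := @idfun (kernel g)) augI.
  exact: res_aug_surj.
by apply: (projective_retract (i := s) (r := res_aug E)) prE.
Qed.

End FinitenessConditions.

Section ResolutionTransport.
Variables (R : pzRingType) (A B : lmodType R) (f : {linear A -> B}).
Hypothesis f_bij : bijective f.
Variable F : resolution A.

Lemma resolution_transport : exists F' : resolution B, res_mod F' = res_mod F.
Proof.
have [g fK gK] := f_bij.
have augS y : exists x, f (res_aug F x) = y.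
  by have [x xE] := res_aug_surj F (g y); exists x; rewrite xE.
have ex0 x : f (res_aug F x) = 0 <-> exists y, res_d F 0 y = x.
  rewrite -res_exact0; split=> [|->]; last exact: linear0.
  by move=> /(congr1 g); rewrite fK -(linear0 f) fK.
by exists (@Resolution R B _ _ (f \o res_aug F)%FUN augS ex0 (@res_exactS _ _ F)).
Qed.

End ResolutionTransport.

(** * Two-periodic resolutions *)

Section PeriodicResolution.
Variables (R : pzRingType) (N A B : lmodType R).
Variables (d : {linear B -> A}) (s : {linear A -> B}) (g : {linear A -> N}).
Hypothesis g_surj : forall y, exists x, g x = y.
Hypothesis gd_exact : forall x, g x = 0 <-> exists y, d y = x.
Hypothesis ds_exact : forall x, d x = 0 <-> exists y, s y = x.
Hypothesis sd_exact : forall x, s x = 0 <-> exists y, d y = x.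

(** Recursion in steps of two makes degrees [j.+2] and [j] convertible, as [two_periodic] asks for
    equalities of modules and of bundled maps. *)
Fixpoint periodic_mod j : lmodType R :=
  match j with 0 => A | 1 => B | i.+2 => periodic_mod i end.

Fixpoint periodic_d j : {linear periodic_mod j.+1 -> periodic_mod j} :=
  match j with 0 => d | 1 => s | i.+2 => periodic_d i end.

Lemma periodic_resolution : exists M : resolution N,
  (forall j, M j = if odd j then B else A) /\ two_periodic M 0.
Proof.
have exS j : forall x, periodic_d j x = 0 <-> exists y, periodic_d j.+1 y = x.
  suff [] : (forall x, periodic_d j x = 0 <-> exists y, periodic_d j.+1 y = x) /\
    (forall x, periodic_d j.+1 x = 0 <-> exists y, periodic_d j.+2 y = x) by [].
  by elim: j => [|j [IH1 IH2]]; split.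
exists (@Resolution R N periodic_mod periodic_d g g_surj gd_exact exS); split=> //.
move=> j; suff [] : periodic_mod j = (if odd j then B else A) /\
  periodic_mod j.+1 = (if odd j.+1 then B else A) by [].
by elim: j => [|j [IH1 IH2]]; split=> //; rewrite /= negbK.
Qed.

End PeriodicResolution.

(** * Reduction modulo a central regular element [w] *)

Section ChangeOfRings.
Variables (R S : pzRingType) (q : {rmorphism R -> S}).

Lemma restrict_linear (M N : lmodType S) (f : {linear M -> N}) :
  linear (f : restrict q M -> restrict q N).
Proof. by move=> a x y; apply: linearP. Qed.

Definition restrict_map (M N : lmodType S) (f : {linear M -> N}) :
  {linear restrict q M -> restrict q N} := mklin (restrict_linear f).

Lemma restrict_scaleE (N : lmodType S) a (x : restrict q N) :
  a *: x = q a *: (x : N).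
Proof. by []. Qed.

Lemma row_restrict_linear r :
  linear (map_mx q : 'rV[R]_r -> restrict q 'rV[S]_r).
Proof.
by move=> a x y; apply/rowP => j; rewrite restrict_scaleE !mxE rmorphD rmorphM.
Qed.

Definition row_restrict r : {linear 'rV[R]_r -> restrict q 'rV[S]_r} :=
  mklin (@row_restrict_linear r).

Hypothesis q_surj : forall b, exists a, q a = b.

Lemma row_restrict_surj r y : exists x, row_restrict r x = y.
Proof.
have ex j : exists a, q a == (y : 'rV[S]_r) 0 j.
  by have [a <-] := q_surj ((y : 'rV[S]_r) 0 j); exists a.
exists (\row_j xchoose (ex j)); apply/rowP => j.
by rewrite !mxE (eqP (xchooseP (ex j))).
Qed.

Lemma finitely_generated_restrict (N : lmodType S) :
  finitely_generated N -> finitely_generated (restrict q N).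
Proof.
move=> /finitely_generatedP[k [f fS]]; apply/finitely_generatedP.
exists k, (restrict_map f \o row_restrict k)%FUN => y.
have [u uE] := fS y; have [x xE] := row_restrict_surj u.
by exists x; rewrite -uE -xE.
Qed.

Variable w : R.
Hypothesis w_central : forall a, w * a = a * w.
Hypothesis w_regular : forall a, w * a = 0 -> a = 0.
Hypothesis q_ker : forall a, q a = 0 <-> exists b, w * b = a.

Lemma quotient_w0 : q w = 0.
Proof. by apply/q_ker; exists 1; rewrite mulr1. Qed.

Lemma scale_w_restrict (N : lmodType S) (x : restrict q N) : w *: x = 0.
Proof. by rewrite restrict_scaleE quotient_w0 scale0r. Qed.

Lemma scale_w_linear (M : lmodType R) : linear (fun x : M => w *: x).
Proof. by move=> a x y; rewrite scalerDr !scalerA w_central. Qed.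

Definition scale_w (M : lmodType R) : {linear M -> M} :=
  mklin (@scale_w_linear M).

(* p exhibits P' as P / wP, for a w-torsion-free module P. *)
Definition reduction (P : lmodType R) (P' : lmodType S)
    (p : {linear P -> restrict q P'}) : Prop :=
  [/\ forall y, exists x, p x = y, forall x, p x = 0 <-> exists y, w *: y = x
    & forall x : P, w *: x = 0 -> x = 0].

Lemma reduction_descend (P : lmodType R) (P' N : lmodType S)
    (p : {linear P -> restrict q P'}) (f : {linear P -> restrict q N}) :
  reduction p -> exists f' : {linear P' -> N}, forall x, f' (p x) = f x.
Proof.
move=> [pS pK _]; have [|g gE] := linear_descend (p := p) (f := f) pS.
  by move=> x /pK[y <-]; rewrite linearZ_LR scale_w_restrict.
(* Every scalar of [S] comes from [R], so linearity over [R] gives linearity over [S]. *)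
have gl : linear (g : P' -> N).
  by move=> b x y; have [a <-] := q_surj b; apply: (linearP g a x y).
by exists (mklin gl).
Qed.

Lemma row_reduction r : reduction (row_restrict r).
Proof.
split=> [|x|x wx]; first exact: row_restrict_surj.
  split=> [x0|[y <-]]; last by rewrite linearZ_LR scale_w_restrict.
  have ex j : exists b, w * b == x 0 j.
    have [|b <-] := proj1 (q_ker (x 0 j)); last by exists b.
    by move: x0 => /(congr1 (fun z : 'rV[S]_r => z 0 j)); rewrite !mxE.
  exists (\row_j xchoose (ex j)); apply/rowP => j.
  by rewrite !mxE (eqP (xchooseP (ex j))).
apply/rowP => j; rewrite mxE; apply: w_regular.
by move: wx => /(congr1 (fun z : 'rV[R]_r => z 0 j)); rewrite !mxE.
Qed.

Lemma free_reduction (P : lmodType R) r :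
  free_of_rank P r -> exists p : {linear P -> restrict q 'rV[S]_r}, reduction p.
Proof.
move=> [f /linear_bij_inv[g fK gK]].
have [rS rK rR] := row_reduction r.
exists (row_restrict r \o g)%FUN; split=> [y|x|x wx].
- by have [x <-] := rS y; exists (f x); rewrite [LHS]/= fK.
- rewrite [X in X = 0]/(row_restrict r (g x)) rK; split=> -[y yE].
    by exists (f y); rewrite -linearZ_LR yE gK.
  by exists (g y); rewrite -linearZ_LR yE.
- by rewrite -[x]gK (rR (g x)) ?linear0 // -linearZ_LR wx linear0.
Qed.

(* P is the image of an idempotent of a free module, and P' is the image of
   the reduced idempotent, presented as the kernel of its complement. *)
Lemma projective_reduction (P : lmodType R) :
  projective P -> finitely_generated P ->
  exists (P' : lmodType S) (p : {linear P -> restrict q P'}),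
    [/\ projective P', finitely_generated P' & reduction p].
Proof.
move=> prP /finitely_generatedP[k [r rS]].
have [i iK] := projective_surj_section prP rS.
have [_ cK cR] := row_reduction k.
have [e eE] := reduction_descend (row_restrict k \o i \o r)%FUN (row_reduction k).
have {}eE x : e (row_restrict k x) = row_restrict k (i (r x)) := eE x.
have ee y : e (e y) = e y.
  by have [x <-] := row_restrict_surj y; rewrite !eE iK.
have dl : linear (fun y => y - e y).
  by move=> a x y; rewrite !linearP /= scalerDr addrACA.
pose P' := kernel (mklin dl).
have fixP y : (exists z : P', kernel_val _ z = y) <-> e y = y.
  split=> [[z <-]|ey]; last by apply: kernel_lift; rewrite /= ey subrr.
  by move: (kernelP z) => /= /eqP; rewrite subr_eq0 => /eqP/esym.
have [y|t tE] := linear_factor (f := e) (@kernel_val_inj _ _ _ (mklin dl)).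
  by apply/fixP.
have tK : cancel (kernel_val (mklin dl)) t.
  by move=> z; apply: kernel_val_inj; rewrite tE; apply/fixP; exists z.
have [|x|p pE] := linear_factor (k := restrict_map (kernel_val (mklin dl)))
    (f := (row_restrict k \o i)%FUN).
- exact: kernel_val_inj.
- apply/fixP; change (e (row_restrict k (i x)) = row_restrict k (i x)).
  by rewrite eE iK.
have {}pE x : kernel_val _ (p x) = row_restrict k (i x) := pE x.
exists P', p; split.
- exact: projective_retract tK (@projective_row _ k).
- apply: (finitely_generated_quotient (p := t)); last exact: finitely_generated_row.
  by move=> y; exists (kernel_val _ y).
split=> [y|x|x wx].
- have [x xE] := row_restrict_surj (kernel_val _ y); exists (r x).
  apply: kernel_val_inj; rewrite pE -eE xE; apply/fixP; by exists y.
- split=> [px|[y <-]]; last by rewrite linearZ_LR scale_w_restrict.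
  have [|u uE] := proj1 (cK (i x)); first by rewrite -pE px linear0.
  by exists (r u); rewrite -linearZ_LR uE iK.
- by rewrite -[x]iK (cR (i x)) ?linear0 // -linearZ_LR wx linear0.
Qed.

Section MatrixFactorization.
Variables (N A B : lmodType S) (P0 P1 : lmodType R).
Variables (d : {linear P1 -> P0}) (g : {linear P0 -> restrict q N}).
Variables (p0 : {linear P0 -> restrict q A}) (p1 : {linear P1 -> restrict q B}).
Hypotheses (d_inj : injective d) (g_surj : forall y, exists x, g x = y).
Hypothesis gd_exact : forall x, g x = 0 <-> exists y, d y = x.
Hypotheses (red0 : reduction p0) (red1 : reduction p1).

(* Since w kills N, it factors on P0 as d s; the pair (d, s) is a matrix
   factorization of w, hence exact in both senses modulo w. *)
Lemma matrix_factorization_resolution : exists M : resolution N,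
  (forall j, M j = if odd j then B else A) /\ two_periodic M 0.
Proof.
have [p0S p0K reg0] := red0; have [p1S p1K _] := red1.
have [x|s ds] := linear_factor (f := scale_w P0) d_inj.
  by apply/gd_exact; rewrite linearZ_LR scale_w_restrict.
have {}ds x : d (s x) = w *: x := ds x.
have sd x : s (d x) = w *: x by apply: d_inj; rewrite ds linearZ_LR.
(* The composite [d s = w] is injective on [P0], hence so is [s]. *)
have s_inj x y : s x = s y -> x = y.
  move=> sxy; apply/eqP; rewrite -subr_eq0; apply/eqP/reg0.
  by rewrite -ds linearB sxy subrr linear0.
have comp0 (V W : lmodType S) (f : {linear V -> W}) (x : restrict q V) :
  x = 0 -> f x = 0 by move=> ->; apply: (linear0 f).
have [g' g'E] := reduction_descend g red0.
have [d' d'E] := reduction_descend (p0 \o d)%FUN red1.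
have [s' s'E] := reduction_descend (p1 \o s)%FUN red0.
have {}d'E x : d' (p1 x) = p0 (d x) := d'E x.
have {}s'E x : s' (p0 x) = p1 (s x) := s'E x.
apply: (@periodic_resolution _ _ _ _ d' s' g').
- by move=> y; have [x <-] := g_surj y; exists (p0 x).
- move=> y; have [x <-] := p0S y; rewrite g'E; split=> [/gd_exact[z <-]|[z]].
    by exists (p1 z).
  have [t <-] := p1S z; rewrite d'E => e.
  have [|u uE] := proj1 (p0K (x - d t)); first by rewrite linearB -e subrr.
  move: (congr1 g uE); rewrite linearZ_LR scale_w_restrict linearB.
  by rewrite (proj2 (gd_exact (d t))) ?subr0 //; exists t.
(* If [d x = w *: z = d (s z)], then [x = s z] because [d] is injective. The next case is the same
   with [d] and [s] exchanged. *)
- move=> y; have [x <-] := p1S y; rewrite d'E; split=> [/p0K[z zE]|[z]].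
    by exists (p0 z); rewrite s'E; congr (p1 _); apply: d_inj; rewrite ds.
  have [t <-] := p0S z; rewrite s'E => e.
  have [|u uE] := proj1 (p1K (x - s t)); first by rewrite linearB -e subrr.
  apply/p0K; exists (d u + t); rewrite scalerDr -linearZ_LR uE -ds -linearD.
  by rewrite subrK.
- move=> y; have [x <-] := p0S y; rewrite s'E; split=> [/p1K[z zE]|[z]].
    by exists (p1 z); rewrite d'E; congr (p0 _); apply: s_inj; rewrite sd.
  have [t <-] := p1S z; rewrite d'E => e.
  have [|u uE] := proj1 (p0K (x - d t)); first by rewrite linearB -e subrr.
  apply/p1K; exists (s u + t); rewrite scalerDr -linearZ_LR uE -sd -linearD.
  by rewrite subrK.
Qed.

End MatrixFactorization.

Section KernelOverQuotient.
Variables (N V : lmodType S) (P : lmodType R).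
Variables (f : {linear V -> N}) (p : {linear P -> restrict q V}).
Hypothesis red : reduction p.
Hypothesis prP : projective P.
Variable F : resolution (restrict q N).

(** The cone is built from [0 -> P -> P -> V -> 0], whose first map is multiplication by [w]. The
    map [t] exists because [w] kills [N]. If [F] has length [m.+2], the new resolution has length
    [m.+1]. *)
Lemma reduction_kernel_resolution (h : {linear P -> F 0%N}) :
  (forall x, res_aug F (h x) = f (p x)) ->
  exists E : resolution (restrict q (kernel f)),
    res_mod E = fun j => match j with
                | 0 => kernel (cone_bottom h)
                | 1 => (F 2%N * P)%type
                | i.+2 => F i.+3
                end.
Proof.
move=> hE; have [pS pK reg] := red.
have [x|t tE] := projective_lift (u := (h \o scale_w P)%FUN) (v := res_d F 0) prP.
  apply/res_exact0; rewrite -[LHS]/(res_aug F (h (w *: x))).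
  by rewrite !linearZ_LR scale_w_restrict.
have wI : injective (scale_w P).
  move=> x y xy; apply/eqP; rewrite -subr_eq0; apply/eqP/reg.
  by apply/eqP; rewrite scalerBr subr_eq0; apply/eqP.
exact: (cone_resolution (F := F) (k := restrict_map (kernel_val f))
  (g := restrict_map f) (@kernel_val_inj _ _ _ f) (@kernel_val_exact _ _ _ f)
  wI pS pK hE tE).
Qed.

End KernelOverQuotient.

(** The bound is [m.+1] because the base case, a matrix factorization, treats length 1. In the step,
    the free cover [f] over [S] supplies one term, and its kernel has smaller projective dimension
    over [R]. *)
Lemma periodic_resolution_FPinf m (N : lmodType S) :
  type_FPinf N -> has_pd_le (restrict q N) m.+1 ->
  exists M : resolution N, finite_type_projective_resolution M /\ two_periodic M m.
Proof.
elim: m N => [|m IH] N fpN pdN.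
all: have fgN := type_FPinf_finitely_generated fpN.
all: have /finitely_generatedP[b [f fS]] := fgN.
all: have fpK : type_FPinf (kernel f) by
  apply: type_FPinf_kernel fpN => //;
    [exact: projective_row | exact: finitely_generated_row].
all: have redb := row_reduction b.
all: have [redS redK _] := redb.
  pose g : {linear 'rV[R]_b -> restrict q N} := (restrict_map f \o row_restrict b)%FUN.
  have gS y : exists x, g x = y.
    by have [u <-] := fS y; have [x <-] := redS u; exists x.
  have prK : projective (kernel g).
    by apply: pd_le1_projective_kernel pdN => //; apply: projective_row.
  (* There is an exact sequence [0 -> R^b -> kernel g -> kernel f -> 0] with first map [w], and
     [kernel f] is finitely generated because [N] is of type FP-infinity over [S]. *)
  have fgK : finitely_generated (kernel g).
    have [x|i iE] := linear_factor (f := scale_w 'rV[R]_b) (@kernel_val_inj _ _ _ g).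
      by apply: kernel_lift; rewrite linearZ_LR scale_w_restrict.
    have [x|p pE] := linear_factor (k := restrict_map (kernel_val f))
        (f := (row_restrict b \o kernel_val g)%FUN) (@kernel_val_inj _ _ _ f).
      exact: (@kernel_lift _ _ _ f _ (kernelP x)).
    have {}pE x : kernel_val f (p x) = row_restrict b (kernel_val g x) := pE x.
    apply: (finitely_generated_extension (i := i) (p := p)).
    - move=> x px; have [|y yE] := proj1 (redK (kernel_val g x)).
        by rewrite -pE px linear0.
      by exists y; apply: kernel_val_inj; rewrite iE.
    - move=> y; have [x xE] := redS (kernel_val f y).
      have [|z zE] := kernel_lift (f := g) (x := x).
        by rewrite -[LHS]/(f (row_restrict b x)) xE; apply: (@kernelP _ _ _ f y).
      by exists z; apply: kernel_val_inj; rewrite pE zE.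
    - exact: finitely_generated_row.
    - apply: finitely_generated_restrict.
      exact: type_FPinf_finitely_generated.
  have [P1' [p1 [prP1 fgP1 red1]]] := projective_reduction prK fgK.
  have [M [ME MP]] := matrix_factorization_resolution (@kernel_val_inj _ _ _ g) gS
    (@kernel_val_exact _ _ _ g) redb red1.
  exists M; split=> // j; rewrite ME; case: ifP => // _; split.
    exact: projective_row.
  exact: finitely_generated_row.
have [F [prF lF]] := pdN.
have [x|h hE] := projective_lift (u := (restrict_map f \o row_restrict b)%FUN)
    (v := res_aug F) (@projective_row R b).
  exact: res_aug_surj.
have [E EE] := reduction_kernel_resolution redb (@projective_row R b) hE.
have [|M [fM pM]] := IH (kernel f) fpK.
  (* The terms of [F] are only known to be projective. Finite generation is carried through the
     induction by [fpK], over [S]. *)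
  exists E; split=> [j|[|[|j]] //= jm].
    rewrite EE; case: j => [|[|j]] //.
      apply: projective_kernel => //.
        have gS y : exists x, restrict_map f x = y.
          by have [x <-] := fS y; exists x.
        exact: (cone_bottom_surj gS redS hE).
      by apply: projective_prod => //; apply: projective_row.
    by apply: projective_prod => //; apply: projective_row.
  by rewrite EE; apply: lF.
exists (splice (@kernel_val_inj _ _ _ f) fS (@kernel_val_exact _ _ _ f) M); split.
  case=> [|j]; last exact: fM.
  by split; [exact: projective_row | exact: finitely_generated_row].
exact: splice_two_periodic.
Qed.


Lemma sum_parity_rec (rk : nat -> nat) j :
  (\sum_(i < j.+3 | odd i == odd j.+2) rk i =
   \sum_(i < j.+1 | odd i == odd j) rk i + rk j.+2)%N.
Proof.
rewrite big_mkcond 2!big_ord_recr -big_mkcond /= negbK eqxx.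
by case: (odd j); rewrite /= addn0.
Qed.

(** For [h = idfun] the kernel of the bottom map is the graph of [- res_d F 0], hence a copy of
    [F 1]. *)
Lemma kernel_cone_id_free (N : lmodType R) (F : resolution N) r :
  free_of_rank (F 1%N) r ->
  free_of_rank (kernel (cone_bottom (F := F) (L0 := F 0%N) idfun)) r.
Proof.
have il : linear (fun x : F 1%N => (x, - res_d F 0 x) : (F 1%N * F 0%N)%type).
  by move=> a x y; congr pair; rewrite /= !linearP.
set ker := kernel _.
have [x|e eE] := linear_factor (f := mklin il)
    (@kernel_val_inj _ _ _ (cone_bottom (F := F) (L0 := F 0%N) idfun)).
  by apply: kernel_lift; rewrite /= subrr.
apply: (free_of_rank_iso (f := e)).
exists (fun z => (kernel_val _ z).1) => [x|z]; first by rewrite eE.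
apply: kernel_val_inj; rewrite eE; move: (kernelP z).
case: (kernel_val _ z) => u v /eqP; rewrite /= addrC addr_eq0 => /eqP ->.
by [].
Qed.

(** Covering [N] by [F 0] modulo [w] keeps every term free. The ranks are those of the
    Eisenbud-Shamash resolution, with terms [F j + F (j - 2) + ...] modulo [w]. *)
Lemma periodic_resolution_free m (N : lmodType S) (F : resolution (restrict q N))
    (rk : nat -> nat) :
  res_length F m.+1 -> (forall i, free_of_rank (F i) (rk i)) ->
  (forall i, (m.+1 < i)%N -> rk i = 0%N) ->
  exists M : resolution N, two_periodic M m /\
    forall j, free_of_rank (M j) (\sum_(i < j.+1 | odd i == odd j) rk i).
Proof.
elim: m N F rk => [|m IH] N F rk lF frF rk0.
all: have [p0 red0] := free_reduction (frF 0%N).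
  have [p1 red1] := free_reduction (frF 1%N).
  have dI : injective (res_d F 0).
    move=> x y xy; apply/eqP; rewrite -subr_eq0; apply/eqP.
    have [|z <-] := proj1 (res_exactS (r := F) (j := 0) (x - y)).
      by rewrite linearB xy subrr.
    by rewrite (lF 2%N isT z) linear0.
  have [M [ME MP]] := matrix_factorization_resolution dI (@res_aug_surj _ _ F)
    (@res_exact0 _ _ F) red0 red1.
  exists M; split=> // j.
  suff -> : (\sum_(i < j.+1 | odd i == odd j) rk i = if odd j then rk 1 else rk 0)%N.
    rewrite ME; case: (odd j); exists idfun; by exists idfun.
  suff [] : (\sum_(i < j.+1 | odd i == odd j) rk i = if odd j then rk 1 else rk 0)%N
    /\ (\sum_(i < j.+2 | odd i == odd j.+1) rk i = if odd j.+1 then rk 1 else rk 0)%N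
    by [].
  elim: j => [|j [IH1 IH2]].
    by split; rewrite big_mkcond !big_ord_recr big_ord0.
  by split=> //; rewrite sum_parity_rec IH1 (rk0 j.+2) // addn0 /= negbK.
have prF := free_of_rank_projective (frF 0%N).
have [f fE] := reduction_descend (res_aug F) red0.
have fS y : exists x, f x = y.
  by have [x <-] := res_aug_surj F y; exists (p0 x).
have hE x : res_aug F (idfun x) = f (p0 x) by rewrite fE.
have [E EE] := reduction_kernel_resolution red0 prF hE.
pose rk' j := match j with 0 => rk 1 | 1 => rk 2 + rk 0 | i.+2 => rk i.+3 end%N.
have [|||M [MP MF]] := IH (kernel f) E rk'.
- by case=> [|[|j]] //= jm; rewrite EE; apply: lF.
- case=> [|[|j]]; rewrite EE //; first exact: kernel_cone_id_free.
  exact: free_of_rank_prod.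
- by case=> [|[|j]] //= jm; apply: rk0.
exists (splice (@kernel_val_inj _ _ _ f) fS (@kernel_val_exact _ _ _ f) M); split.
  exact: splice_two_periodic.
(* Passing to [rk'] shifts all ranks down by one degree, except that [rk 0] is moved next to [rk 2],
   which has the same parity. *)
have sE j : (\sum_(i < j.+2 | odd i == odd j.+1) rk i =
             \sum_(i < j.+1 | odd i == odd j) rk' i)%N.
  suff [] : (\sum_(i < j.+2 | odd i == odd j.+1) rk i =
             \sum_(i < j.+1 | odd i == odd j) rk' i)%N /\
    (\sum_(i < j.+3 | odd i == odd j.+2) rk i =
             \sum_(i < j.+2 | odd i == odd j.+1) rk' i)%N by [].
  elim: j => [|j [IH1 IH2]].
    by split; rewrite big_mkcond [RHS]big_mkcond !big_ord_recr !big_ord0 //= addn0 addnC.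
  by split=> //; rewrite sum_parity_rec IH1 sum_parity_rec.
case=> [|j]; last by rewrite sE; apply: MF.
by rewrite big_mkcond big_ord_recr big_ord0 /=; exists idfun; exists idfun.
Qed.

End ChangeOfRings.

(** * Group ring elements and the element [c - 1] *)

Section GroupRingElements.
Variable G : groupType.
Implicit Types (x y : groupring G) (g h : G).

Definition gr_elt g : groupring G := << g >>.

Lemma gr_ext (V : zmodType) (f1 f2 : groupring G -> V) :
  {morph f1 : x y / x + y} -> {morph f2 : x y / x + y} ->
  (forall g, f1 (gr_elt g) = f2 (gr_elt g)) -> f1 =1 f2.
Proof.
move=> f1D f2D e x.
by rewrite (gr_lift_unique f1D) (gr_lift_unique f2D); apply: eq_gr_lift.
Qed.

Lemma gr_ind (P : groupring G -> Prop) :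
  P 0 -> (forall x y, P x -> P y -> P (x + y)) -> (forall x, P x -> P (- x)) ->
  (forall g, P (gr_elt g)) -> forall x, P x.
Proof.
move=> P0 PD PN Pg x.
have Pn g n : P (gr_elt g *+ n).
  by elim: n => [|n IH]; rewrite ?mulr0n // mulrS; apply: PD.
have -> : x = gr_lift gr_elt x by apply: (gr_lift_unique (f := id)).
rewrite /gr_lift; apply: big_ind => // g _.
by case: x@_g => n; [apply: Pn | rewrite NegzE mulrNz; apply/PN/Pn].
Qed.

Lemma gr_eltM g h : gr_elt (g * h)%g = gr_elt g * gr_elt h.
Proof. by rewrite -[RHS]/(gr_mul _ _) gr_mulUU. Qed.

Lemma gr_elt1 : gr_elt 1%g = 1.
Proof. by []. Qed.

Lemma gr_eltX g n : gr_elt (g ^+ n)%g = gr_elt g ^+ n.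
Proof.
by elim: n => [|n IH]; rewrite ?expg0 ?expr0 // expgS exprS gr_eltM IH.
Qed.

Lemma gr_coeffD g : {morph (fun x : groupring G => x@_g) : x y / x + y}.
Proof. by move=> x y; apply: mcoeffD. Qed.

Lemma gr_elt_coeff g h : (gr_elt g)@_h = (g == h)%:R.
Proof. by rewrite mcoeffU. Qed.

Lemma gr_mulEl_coeff g x h : (gr_elt g * x)@_h = x@_(g^-1 * h)%g.
Proof.
apply: (gr_ext (f1 := fun x => (gr_elt g * x)@_h)
               (f2 := fun x => x@_(g^-1 * h)%g)).
- by move=> u v; rewrite mulrDr gr_coeffD.
- by move=> u v; rewrite gr_coeffD.
by move=> k; rewrite -gr_eltM !gr_elt_coeff -[in RHS](inj_eq (mulgI g)) mulVKg.
Qed.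

(** This is the trace property of the Kaplansky trace. By biadditivity it reduces to: [g h = 1]
    exactly when [h g = 1]. *)
Lemma gr_coeff1_mulC x y : (x * y)@_1%g = (y * x)@_1%g.
Proof.
apply: (gr_ext (f1 := fun x => (x * y)@_1%g)
               (f2 := fun x => (y * x)@_1%g)) => [u v|u v|g].
- by rewrite mulrDl gr_coeffD.
- by rewrite mulrDr gr_coeffD.
apply: (gr_ext (f1 := fun y => (gr_elt g * y)@_1%g)
               (f2 := fun y => (y * gr_elt g)@_1%g)) => [u v|u v|h].
- by rewrite mulrDr gr_coeffD.
- by rewrite mulrDl gr_coeffD.
rewrite -!gr_eltM !gr_elt_coeff; congr (_ _)%:R.
rewrite -[LHS](inj_eq (mulgI (g^-1)%g)) -[RHS](inj_eq (mulIg (g^-1)%g)).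
by rewrite mulKg mulgK mulg1 mul1g.
Qed.

Lemma gr_elt_central c : central c -> forall x, gr_elt c * x = x * gr_elt c.
Proof.
move=> cC; apply: gr_ext => [u v|u v|g]; first by rewrite mulrDr.
  by rewrite mulrDl.
by rewrite -!gr_eltM cC.
Qed.

Lemma gr_elt_sub1_central c : central c ->
  forall x, (gr_elt c - 1) * x = x * (gr_elt c - 1).
Proof.
by move=> cC x; rewrite mulrBl mulrBr mul1r mulr1 gr_elt_central.
Qed.

(** If [c x = x], the coefficients of [x] are constant along the orbits of [c], which are infinite,
    while the support is finite. *)
Lemma gr_elt_sub1_regular c : (forall m, (0 < m)%N -> (c ^+ m)%g <> 1%g) ->
  forall x, (gr_elt c - 1) * x = 0 -> x = 0.
Proof.
move=> c_inf x /eqP; rewrite mulrBl mul1r subr_eq0 => /eqP cx.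
have coef n h : x@_(c ^+ n * h)%g = x@_h.
  elim: n h => [|n IH] h; first by rewrite expg0 mul1g.
  by rewrite -[in LHS]cx gr_mulEl_coeff expgS -mulgA mulKg IH.
apply/malgP => h; rewrite mcoeff0; apply/eqP; case: eqP => // /eqP.
rewrite mcoeff_neq0 => hx; exfalso.
(* Pigeonhole: these are distinct points of the support, one more than it has. *)
pose s := [seq (c ^+ n * h)%g | n <- iota 0 (size (msupp x)).+1].
have : (size s <= size (msupp x))%N.
  apply: uniq_leq_size => [|k /mapP[n _ ->]].
    rewrite map_inj_uniq ?iota_uniq // => i j /mulIg.
    wlog ij : i j / (i <= j)%N.
      by case/orP: (leq_total i j) => ij H e; [apply: H | apply/esym/H].
    rewrite -(subnKC ij) expgnDr -[LHS]mulg1 => /mulgI/esym e.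
    by case: (posnP (j - i)) => [->|/c_inf //]; rewrite addn0.
  by rewrite -mcoeff_neq0 coef mcoeff_neq0.
by rewrite size_map size_iota ltnn.
Qed.

End GroupRingElements.

(** * The kernel of the map of group rings induced by [pi] *)

Section QuotientByCycle.
Variables (G Q : groupType) (c : G) (pi : {multiplicative G -> Q}).
Hypothesis c_quot : quotient_by_cycle pi c.

Let section_ex (y : Q) : exists g, pi g == y.
Proof. by have [g <-] := proj1 c_quot y; exists g. Qed.

Let sec (y : Q) : G := xchoose (section_ex y).

Let secK y : pi (sec y) = y.
Proof. exact: (eqP (xchooseP (section_ex y))). Qed.

(** An additive section only, since [sec] is a mere choice of preimages. *)
Let gr_sec (y : groupring Q) : groupring G := gr_lift (fun k => gr_elt (sec k)) y.

Let gr_secD : {morph gr_sec : x y / x + y}.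
Proof. exact: gr_liftD. Qed.

Lemma gr_map_surj b : exists a, gr_map pi a = b.
Proof.
exists (gr_sec b).
apply: (gr_ext (f1 := fun b => gr_map pi (gr_sec b)) (f2 := id)) => // [u v|g].
  by rewrite gr_secD rmorphD.
by rewrite /gr_sec gr_liftU mulr1z gr_mapU secK.
Qed.

Let power_mem k : exists b, (gr_elt c - 1) * b = gr_elt (c ^+ k)%g - 1.
Proof. by rewrite gr_eltX subrX1; eexists. Qed.

Let kernel_mem g : pi g = 1%g -> exists b, (gr_elt c - 1) * b = gr_elt g - 1.
Proof.
move=> /(proj2 c_quot)[k [->|->]]; first exact: power_mem.
(* From the identity [c^(-k) - 1 = - (c^k - 1) c^(-k)]. *)
have [b bE] := power_mem k; exists (- (b * gr_elt (c ^- k)%g)).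
by rewrite mulrN mulrA bE mulrBl mul1r -gr_eltM mulgV opprB.
Qed.

Lemma gr_map_ker a : gr_map pi a = 0 <-> exists b, (gr_elt c - 1) * b = a.
Proof.
split=> [a0|[b <-]]; last first.
  rewrite rmorphM rmorphB rmorph1 /= gr_mapU.
  have -> : pi c = 1%g by apply/(proj2 c_quot); exists 1; left; rewrite expg1.
  by rewrite subrr mul0r.
(* Modulo [c - 1] every element agrees with the lift of its image. By additivity it suffices to
   check group elements, where [g] and [sec (pi g)] differ by a power of [c]. *)
suff : exists b, (gr_elt c - 1) * b = a - gr_sec (gr_map pi a).
  by rewrite a0 /gr_sec gr_lift0 subr0.
have gr_secN y : gr_sec (- y) = - gr_sec y.
  by apply: (addIr (gr_sec y)); rewrite -gr_secD !addNr /gr_sec gr_lift0.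
move: a {a0}; apply: gr_ind => [|x y [b bE] [b' b'E]|x [b bE]|g].
- by exists 0; rewrite mulr0 rmorph0 /gr_sec gr_lift0 subr0.
- exists (b + b'); rewrite mulrDr bE b'E rmorphD gr_secD opprD.
  by rewrite addrACA.
- by exists (- b); rewrite mulrN bE rmorphN gr_secN opprB opprK addrC.
rewrite gr_mapU /gr_sec gr_liftU mulr1z.
have [|b bE] := @kernel_mem (g * (sec (pi g))^-1)%g.
  have : pi (g * (sec (pi g))^-1 * sec (pi g))%g = pi g by rewrite mulgVK.
  by rewrite gmulfM secK -[RHS]mul1g => /mulIg.
exists (b * gr_elt (sec (pi g))); rewrite mulrA bE mulrBl mul1r -gr_eltM.
by rewrite mulgVK.
Qed.

End QuotientByCycle.

(** * Tate acyclicity of modules with a finite projective resolution *)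

Section TateAcyclicity.
Variable R : pzRingType.
Implicit Types (u v : R) (A B C P : lmodType R).

(* One half of the vanishing of the Tate cohomology, with respect to the pair
   (u, v), of the image of f. *)
Definition image_exact u v A B (f : {linear A -> B}) : Prop :=
  forall x, u *: f x = 0 -> exists y, f x = v *: f y.

(** Dimension shifting along [0 -> im i -> B -> im p -> 0]: the middle term is acyclic, so the
    condition passes from [im i] to [im p] with [u] and [v] exchanged. *)
Lemma image_exact_shift u v A B C (i : {linear A -> B}) (p : {linear B -> C}) :
  v * u = 0 -> (forall x, p x = 0 <-> exists y, i y = x) ->
  image_exact u v (@idfun B) -> image_exact v u i -> image_exact u v p.
Proof.
move=> vu ip exB exi x; rewrite -linearZ_LR => /ip[a aE].
have [|a' a'E] := exi a; first by rewrite aE scalerA vu scale0r.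
have [|y yE] := exB (x - i a').
  by rewrite scalerBr -[X in _ - X]a'E aE subrr.
exists y; rewrite -linearZ_LR -[RHS](congr1 p yE) /= linearB.
by rewrite [p (i a')](proj2 (ip _)) ?subr0 //; exists a'.
Qed.

Lemma image_exact_projective u v P :
  (forall a, u * a = 0 -> exists b, a = v * b) ->
  projective P -> finitely_generated P -> image_exact u v (@idfun P).
Proof.
move=> uv prP /finitely_generatedP[k [r rS]] x /= ux.
have [i iK] := projective_surj_section prP rS.
have ex j : exists b, i x 0 j == v * b.
  have [|b ->] := uv (i x 0 j); last by exists b.
  by move: (linearZ_LR i u x); rewrite ux linear0 => /rowP/(_ j); rewrite !mxE.
exists (r (\row_j xchoose (ex j))); rewrite -linearZ_LR -[LHS]iK; congr (r _).
by apply/rowP => j; rewrite !mxE -(eqP (xchooseP (ex j))).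
Qed.

(** The images of the differentials are acyclic beyond the length, and dimension shifting brings
    this down to [N]. As the roles of [u] and [v] alternate, both conditions are carried
    together. *)
Lemma exact_of_finite_resolution u v (N : lmodType R) (M : resolution N) n :
  u * v = 0 -> v * u = 0 ->
  (forall a, u * a = 0 -> exists b, a = v * b) ->
  (forall a, v * a = 0 -> exists b, a = u * b) ->
  finite_type_projective_resolution M -> res_length M n ->
  forall x : N, u *: x = 0 -> exists y, x = v *: y.
Proof.
move=> uv vu exu exv fM lM.
have exM j : image_exact u v (@idfun (M j)) /\ image_exact v u (@idfun (M j)).
  by have [? ?] := fM j; split; apply: image_exact_projective.
(* Descending induction on the degree [k], with [i] bounding the distance to [n]. *)
have exd i k : (n <= k + i)%N ->
    image_exact u v (res_d M k) /\ image_exact v u (res_d M k).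
  elim: i k => [|i IH] k nk.
    have trM : trivial_module (M k.+1) by apply: lM; rewrite ltnS -(addn0 k).
    by split=> x _; exists 0; rewrite (trM x) !linear0 scaler0.
  have [IH1 IH2] := IH k.+1 ltac:(by rewrite addSnnS).
  have [M1 M2] := exM k.+1.
  by split; [apply: image_exact_shift IH2 | apply: image_exact_shift IH1] => //;
    apply: res_exactS.
have [_ ex0] := exd n 0%N (leqnn n).
move=> y; have [x <-] := res_aug_surj M y => ux.
have [z zE] := image_exact_shift vu (@res_exact0 _ _ M) (proj1 (exM 0%N)) ex0 ux.
by exists (res_aug M z).
Qed.

End TateAcyclicity.

(** * Central elements of finite order, with [u = c - 1] and the norm element [v] *)

Section FiniteOrder.
Variables (G : groupType) (c : G) (m : nat).
Hypotheses (c_central : central c) (m_gt0 : (0 < m)%N) (cm : (c ^+ m)%g = 1%g).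
Hypothesis m_min : forall k, (0 < k < m)%N -> (c ^+ k)%g <> 1%g.

Let C : groupring G := gr_elt c.
Let u : groupring G := C - 1.
Let v : groupring G := \sum_(i < m) C ^+ i.

Let Cm : C ^+ m = 1.
Proof. by rewrite -gr_eltX cm. Qed.

Let uv : u * v = 0.
Proof. by rewrite -subrX1 Cm subrr. Qed.

Let vu : v * u = 0.
Proof. by rewrite -gr_elt_sub1_central. Qed.

Let expg_modm i : (c ^+ i)%g = (c ^+ (i %% m))%g.
Proof. by rewrite {1}(divn_eq i m) expgnDr mulnC expgnA cm expg1n mul1g. Qed.

Let orb (g h : G) : bool := [exists i : 'I_m, h == (c ^+ i * g)%g].

Let orbP g h : reflect (exists i, h = (c ^+ i * g)%g) (orb g h).
Proof.
apply: (iffP existsP) => [[i /eqP ->]|[i ->]]; first by exists i.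
by exists (Ordinal (ltn_pmod i m_gt0)); rewrite /= -expg_modm.
Qed.

Let rep (g : G) : G := choose (orb g) g.

Let rep_orb g : orb g (rep g).
Proof. by apply: chooseP; apply/orbP; exists 0%N; rewrite expg0 mul1g. Qed.

Let rep_power i g : rep (c ^+ i * g)%g = rep g.
Proof.
have e : orb (c ^+ i * g)%g =1 orb g.
  move=> h; apply/orbP/orbP => -[k ->].
    by exists (k + i)%N; rewrite mulgA expgnDr.
  (* The exponent [m - i %% m] expresses the inverse of [c ^+ i] as a non-negative power. *)
  exists (k + (m - i %% m))%N; rewrite mulgA -expgnDr -addnA expgnDr.
  rewrite (expg_modm (m - i %% m + i)) -modnDmr subnK ?modnn ?expg0 ?mulg1 //.
  exact/ltnW/ltn_pmod.
(* The value of [choose] does not depend on its default point as long as that point satisfies the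
   predicate. *)
rewrite /rep (eq_choose e); apply: choose_id; apply/orbP; first by exists i.
by exists 0%N; rewrite expg0 mul1g.
Qed.

Let rho (x : groupring G) : groupring G :=
  gr_lift (fun g => if rep g == g then gr_elt g else 0) x.

Let rhoD : {morph rho : x y / x + y}.
Proof. exact: gr_liftD. Qed.

Let rho_sum I (r : seq I) (F : I -> groupring G) :
  rho (\sum_(i <- r) F i) = \sum_(i <- r) rho (F i).
Proof. exact: gr_lift_sum. Qed.

(* Z G is induced from the trivial subgroup of the cycle of c: rho projects onto the
   span of a transversal. *)
Let transversal_decomposition x :
  x = \sum_(i < m) C ^+ (m - i) * rho (C ^+ i * x).
Proof.
apply: (gr_ext (f1 := id) (f2 := fun x =>
  \sum_(i < m) C ^+ (m - i) * rho (C ^+ i * x))) => // [y z|g].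
  by rewrite -big_split; apply: eq_bigr => i _; rewrite /= mulrDr rhoD mulrDr.
have /existsP[k /eqP kE] := rep_orb g.
(* Since [c] has order exactly [m], only the index [k] moves [g] onto the representative of its
   orbit. *)
rewrite (bigD1 k) //= big1 => [|i ik].
  rewrite -!gr_eltX -[X in rho X]gr_eltM /rho gr_liftU mulr1z rep_power kE eqxx.
  rewrite -gr_eltM mulgA -expgnDr subnK 1?ltnW // cm mul1g.
  by rewrite addr0.
rewrite -[C ^+ i]gr_eltX -[X in rho X]gr_eltM /rho gr_liftU mulr1z rep_power kE.
case: eqP => [/mulIg e|_]; last by rewrite mulr0.
have nlt (a b : 'I_m) : (c ^+ a)%g = (c ^+ b)%g -> (a < b)%N -> False.
  move=> ab lt; apply: (@m_min (b - a)%N).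
    by rewrite subn_gt0 lt (leq_ltn_trans (leq_subr _ _)).
  by apply: (mulgI (c ^+ a)%g); rewrite -expgnDr subnKC 1?ltnW // mulg1.
case: (ltngtP i k) => [lt|lt|e'].
- by case: (nlt i k).
- by case: (nlt k i).
- by rewrite (val_inj e') eqxx in ik.
Qed.

Let Cv : C * v = v.
Proof. by apply/eqP; rewrite -subr_eq0 -[X in _ - X]mul1r -mulrBl uv. Qed.

(** When [C * a = a], every summand of the decomposition involves the same [rho a], and the powers
    [C ^+ (m - i)] add up to [C * v = v]. *)
Let exact_u a : u * a = 0 -> exists b, a = v * b.
Proof.
rewrite mulrBl mul1r => /eqP; rewrite subr_eq0 => /eqP Ca.
have Cia i : C ^+ i * a = a.
  by elim: i => [|i IH]; rewrite ?expr0 ?mul1r // exprSr -mulrA Ca.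
exists (rho a); rewrite {1}(transversal_decomposition a) -Cv [C * v]mulr_sumr mulr_suml.
rewrite (reindex_inj rev_ord_inj); apply: eq_bigr => i _ /=.
by rewrite Cia subKn ?ltn_ord // exprS.
Qed.

(** The elements [rho (C ^+ i * a)] add up to [rho (v * a) = 0], so each [C ^+ (m - i)] may be
    replaced by [C ^+ (m - i) - 1], a multiple of [u]. *)
Let exact_v a : v * a = 0 -> exists b, a = u * b.
Proof.
move=> va; exists (\sum_(i < m) (\sum_(j < m - i) C ^+ j) * rho (C ^+ i * a)).
rewrite {1}(transversal_decomposition a) mulr_sumr.
have -> : \sum_(i < m) C ^+ (m - i) * rho (C ^+ i * a) =
    \sum_(i < m) (C ^+ (m - i) - 1) * rho (C ^+ i * a) + rho (v * a).
  rewrite mulr_suml rho_sum -big_split; apply: eq_bigr => i _ /=.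
  by rewrite mulrBl mul1r subrK.
rewrite va /rho gr_lift0 addr0; apply: eq_bigr => i _.
by rewrite subrX1 mulrA.
Qed.

(** On the trivial module [u] acts as 0 and [v] as [m], so acyclicity makes 1 a multiple of [m] in
    the integers. *)
Lemma type_FP_central_order1 : type_FP G -> m = 1%N.
Proof.
move=> [M [n [fM lM]]].
have [|y] := exact_of_finite_resolution uv vu exact_u exact_v fM lM (x := 1 : int).
  rewrite -[LHS]/(gr_aug u * 1) rmorphB rmorph1 /= gr_augU subrr.
  by rewrite mul0r.
rewrite -[RHS]/(gr_aug v * y) rmorph_sum.
under eq_bigr => i _ do rewrite rmorphXn /= gr_augU expr1n.
rewrite sumr_const card_ord => e.
move: (congr1 absz e); rewrite natz abszM => /esym/eqP.
by rewrite muln_eq1 => /andP[/eqP].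
Qed.

End FiniteOrder.

Lemma type_FP_central_infinite_order (G : groupType) (c : G) :
  type_FP G -> central c -> c <> 1%g ->
  forall m, (0 < m)%N -> (c ^+ m)%g <> 1%g.
Proof.
move=> fpG cC c1 m m_gt0 cm.
have ex : exists k, (0 < k)%N && (c ^+ k == 1)%g.
  by exists m; rewrite m_gt0 cm eqxx.
case: (ex_minnP ex) => k /andP[k_gt0 /eqP ck] k_min.
suff k1 : k = 1%N by apply: c1; rewrite -(expg1 c) -k1.
apply: (type_FP_central_order1 cC k_gt0 ck _ fpG) => l /andP[l_gt0 lk] cl.
by have := k_min l; rewrite l_gt0 cl eqxx leqNgt lk => /(_ isT).
Qed.

(** * Traces and the vanishing of the Euler characteristic *)

Section Trace.
Variables (R : pzRingType) (tau : {additive R -> int}).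
Hypothesis tau_mulC : forall a b, tau (a * b) = tau (b * a).

(** For mutually inverse [phi] and [psi] and linear [f], this is [tau] of the Hattori-Stallings
    trace. Taking [f] as a bare function lets composites be supplied unbundled. *)
Definition basis_trace (P : lmodType R) r (phi : {linear 'rV[R]_r -> P})
    (psi : {linear P -> 'rV[R]_r}) (f : P -> P) : int :=
  \sum_i tau (psi (f (phi (delta_mx 0 i))) 0 i).

Lemma basis_trace_comp (P Q : lmodType R) r s (phi : {linear 'rV[R]_r -> P})
    (psi : {linear P -> 'rV[R]_r}) (phi' : {linear 'rV[R]_s -> Q})
    (psi' : {linear Q -> 'rV[R]_s}) (f : {linear P -> Q}) (g : {linear Q -> P}) :
  cancel psi' phi' ->
  basis_trace phi psi (fun x => g (f x)) =
  \sum_i \sum_k tau (psi' (f (phi (delta_mx 0 i))) 0 k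
                     * psi (g (phi' (delta_mx 0 k))) 0 i).
Proof.
move=> psiK; apply: eq_bigr => i _; set y := f _.
rewrite -{1}[y]psiK [psi' y in LHS]row_sum_delta !linear_sum summxE raddf_sum.
by apply: eq_bigr => k _; rewrite !linearZ_LR mxE.
Qed.

Lemma basis_trace_comm (P Q : lmodType R) r s (phi : {linear 'rV[R]_r -> P})
    (psi : {linear P -> 'rV[R]_r}) (phi' : {linear 'rV[R]_s -> Q})
    (psi' : {linear Q -> 'rV[R]_s}) (f : {linear P -> Q}) (g : {linear Q -> P}) :
  cancel psi phi -> cancel psi' phi' ->
  basis_trace phi psi (fun x => g (f x)) = basis_trace phi' psi' (fun x => f (g x)).
Proof.
move=> psiK psiK'.
rewrite (basis_trace_comp phi psi f g psiK') (basis_trace_comp phi' psi' g f psiK).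
by rewrite exchange_big; do 2!apply: eq_bigr => ? _; rewrite tau_mulC.
Qed.

Variable w : R.
Hypotheses (w_central : forall a, w * a = a * w) (tau_w : tau w = -1).

Lemma basis_trace_scale (P : lmodType R) r (phi : {linear 'rV[R]_r -> P})
    (psi : {linear P -> 'rV[R]_r}) (f : {linear P -> P}) : cancel phi psi ->
  basis_trace phi psi (fun x => w *: x - f x) = - r%:Z - basis_trace phi psi f.
Proof.
move=> phiK; rewrite -[X in - X%:Z]card_ord -natz -mulNrn -sumr_const -sumrB.
apply: eq_bigr => i _; rewrite linearB linearZ_LR phiK !mxE !eqxx mulr1 raddfB.
by rewrite tau_w.
Qed.

Variables (N : lmodType R) (F : resolution N) (rk : nat -> nat) (n : nat).
Hypotheses (wN : forall x : N, w *: x = 0) (lF : res_length F n).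
Hypothesis frF : forall i, free_of_rank (F i) (rk i).

(* Multiplication by w is null-homotopic on F, because w kills N. Taking
   traces in a homotopy s d + d s = w makes the ranks telescope. *)
Lemma euler_characteristic0 :
  (\sum_(i < n.+1 | ~~ odd i) rk i = \sum_(i < n.+1 | odd i) rk i)%N.
Proof.
pose O j := (\sum_(i < j.+1 | odd i) rk i)%N.
pose E j := (\sum_(i < j.+1 | ~~ odd i) rk i)%N.
have OS j : O j.+1 = (O j + odd j.+1 * rk j.+1)%N.
  by rewrite /O big_mkcond big_ord_recr -big_mkcond /=; case: (odd j); rewrite ?mul1n.
have ES j : E j.+1 = (E j + ~~ odd j.+1 * rk j.+1)%N.
  by rewrite /E big_mkcond big_ord_recr -big_mkcond /=; case: (odd j); rewrite ?mul1n.
(* The first clause is the homotopy relation precomposed with the differential, which suffices to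
   build the next [s]. *)
have homotopy j : exists s : {linear F j -> F j.+1},
    (forall x, w *: res_d F j x = res_d F j (s (res_d F j x))) /\
    forall (phi : {linear 'rV[R]_(rk j) -> F j}) (psi : {linear F j -> 'rV[R]_(rk j)}),
    cancel phi psi -> cancel psi phi ->
    basis_trace phi psi (fun x => res_d F j (s x)) =
      (-1) ^+ j * ((O j)%:Z - (E j)%:Z).
  elim: j => [|j [s [sE sT]]].
    have [x|s sE] := projective_lift (u := scale_w w_central (F 0%N)) (v := res_d F 0)
        (free_of_rank_projective (frF 0%N)).
      by apply/res_exact0; rewrite linearZ_LR wN.
    have {}sE x : res_d F 0 (s x) = w *: x := sE x.
    exists s; split=> [x|phi psi phiK psiK]; first by rewrite sE.
    have zl : linear (fun _ : F 0%N => 0 : F 0%N).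
      by move=> a x y; rewrite scaler0 addr0.
    have := basis_trace_scale (mklin zl) phiK.
    rewrite [X in _ = _ - X]big1 => [|i _]; last by rewrite /= linear0 mxE raddf0.
    have -> : O 0%N = 0%N by rewrite /O big_mkcond big_ord_recr big_ord0.
    have -> : E 0%N = rk 0%N by rewrite /E big_mkcond big_ord_recr big_ord0.
    rewrite subr0 expr0 mul1r sub0r => <-.
    by apply: eq_bigr => i _; rewrite sE /= subr0.
  have ul : linear (fun x : F j.+1 => w *: x - s (res_d F j x)).
    move=> a x y; rewrite scalerDr !scalerA w_central -scalerA !linearP /=.
    by rewrite scalerDr addrACA.
  have [x|s' s'E] := projective_lift (u := mklin ul) (v := res_d F j.+1)
      (free_of_rank_projective (frF j.+1)).
    by apply/res_exactS; rewrite /= linearB linearZ_LR /= sE subrr.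
  have {}s'E x : res_d F j.+1 (s' x) = w *: x - s (res_d F j x) := s'E x.
  exists s'; split=> [x|phi psi phiK psiK]; first by rewrite s'E res_dd linear0 subr0.
  have [phi0 /linear_bij_inv[psi0 phi0K psi0K]] := frF j.
  (* In [d s' = w - s d] the term [w] contributes minus the rank, and [s d] has the same trace as
     [d s] one degree lower. *)
  transitivity (- (rk j.+1)%:Z - basis_trace phi psi (s \o res_d F j)%FUN).
    by rewrite -basis_trace_scale //; apply: eq_bigr => i _; rewrite s'E.
  rewrite (basis_trace_comm (res_d F j) s psiK psi0K) sT // OS ES exprS !PoszD.
  rewrite -signr_odd /=; case: (odd j); rewrite /= ?mul0n ?mul1n; ring.
have [s [_ sT]] := homotopy n.
have [phi /linear_bij_inv[psi phiK psiK]] := frF n.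
(* In degree [n] the map [s] lands in [F n.+1 = 0], so the trace vanishes. *)
have := sT phi psi phiK psiK; rewrite /basis_trace big1 => [/eqP|i _].
  by rewrite eq_sym mulf_eq0 signr_eq0 subr_eq0 => /eqP[].
by rewrite (lF (ltnSn n) (s _)) !linear0 mxE raddf0.
Qed.

End Trace.

(** * Specialization to [w = c - 1] in the group ring of [G] *)

Theorem corollary7p12 (G Q : groupType) (c : G)
    (pi : {multiplicative G -> Q}) :
  type_FP G ->
  (exists d : nat, has_cd G d) ->
  central c ->
  c <> 1%g ->
  quotient_by_cycle pi c ->
  type_VFP Q ->
  (forall (N : lmodType (groupring Q)) (n : nat),
     type_FPinf N ->
     has_pd (restrict (gr_map pi) N) n ->
     exists M : resolution N,
       finite_type_projective_resolution M /\ two_periodic M n.-1)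
  /\
  (type_FL G ->
   forall (n : nat) (F : resolution (trivial_mod G)) (rk : nat -> nat),
     has_cd G n ->
     res_length F n ->
     (forall i, free_of_rank (F i) (rk i)) ->
     let r := (\sum_(i < n.+1 | ~~ odd i) rk i)%N in
     r = (\sum_(i < n.+1 | odd i) rk i)%N /\
     exists M : resolution (trivial_mod Q),
       [/\ finite_type_projective_resolution M, two_periodic M n.-1
         & forall j, (n.-1 <= j)%N -> free_of_rank (M j) r]).
Proof.
move=> fpG _ cC c1 quot _.
have wC := gr_elt_sub1_central cC.
have wR := gr_elt_sub1_regular (type_FP_central_infinite_order fpG cC c1).
have qS := gr_map_surj quot.
have qK := gr_map_ker quot.
split=> [N n fpN [[F [prF lF]] _]|_ n F rk _ lF frF r].
  apply: (periodic_resolution_FPinf qS wC wR qK) => //.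
  (* The bound used is [n.-1.+1], which is 1 when [n = 0]. *)
  by exists F; split=> // j jn; apply: lF; apply: leq_trans jn; apply: leqSpred.
have tauD : GRing.nmod_morphism (fun x : groupring G => x@_1%g).
  by split=> [|x y]; [apply: mcoeff0 | apply: mcoeffD].
pose tau : {additive groupring G -> int} :=
  HB.pack (fun x : groupring G => x@_1%g) (GRing.isNmodMorphism.Build _ _ _ tauD).
have tau_w : tau (gr_elt c - 1) = -1.
  rewrite raddfB /= -(gr_elt1 G) !gr_elt_coeff eqxx.
  by case: eqP c1 => // _ _; rewrite sub0r.
have wZ (x : trivial_mod G) : (gr_elt c - 1) *: x = 0.
  rewrite -[LHS]/(gr_aug (gr_elt c - 1) * (x : int)) rmorphB rmorph1 /=.
  by rewrite gr_augU subrr mul0r.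
have tauC : forall a b, tau (a * b) = tau (b * a) := @gr_coeff1_mulC G.
have EO := euler_characteristic0 tauC wC tau_w wZ lF frF.
split=> //.
(* The two actions on the integers agree because the augmentation of [G] factors through
   [gr_map pi]. *)
have idl : linear (id : trivial_mod G -> restrict (gr_map pi) (trivial_mod Q)).
  move=> a x y; congr (_ + _); rewrite -[LHS]/(gr_aug a * (x : int)).
  rewrite -[RHS]/(gr_aug (gr_map pi a) * (x : int)); congr (_ * _).
  apply: (gr_ext (f1 := @gr_aug G) (f2 := fun a => gr_aug (gr_map pi a)))
    => [u v|u v|g].
  - exact: raddfD.
  - by rewrite !raddfD.
  - by rewrite gr_mapU !gr_augU.
have idb : bijective (mklin idl) by exists id.
have [F' F'E] := resolution_transport idb F.
(* The group ring is nonzero, so a free module of positive rank is nontrivial. *)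
have rk0 i : (n < i)%N -> rk i = 0%N.
  move=> /lF trF; have [f fb] := frF i; case: (rk i) f fb => // k f /bij_inj fI.
  have : delta_mx 0 0 = 0 :> 'rV[groupring G]_k.+1.
    by apply: fI; rewrite (trF (f _)) linear0.
  by move=> /rowP/(_ 0)/eqP; rewrite !mxE oner_eq0.
have le_n : (n <= n.-1.+1)%N by apply: leqSpred.
have [||i|M [MP MF]] := periodic_resolution_free qS wC wR qK
  (m := n.-1) (F := F') (rk := rk).
- by move=> j jn; rewrite F'E; apply: lF; apply: leq_trans jn.
- by move=> i; rewrite F'E.
- by move=> jn; apply: rk0; apply: leq_trans jn.
exists M; split=> // j.
  by split; [apply: free_of_rank_projective (MF j)
           | apply: free_of_rank_finitely_generated (MF j)].
move=> jn; suff -> : r = (\sum_(i < j.+1 | odd i == odd j) rk i)%N by [].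
have nj : (n <= j.+1)%N by apply: leq_trans le_n _.
(* For [j = n - 1] the range must reach [j.+1] to contain all nonzero ranks. The added index has
   parity opposite to [j] and does not change the sum wanted. *)
have widen b : (\sum_(i < j.+2 | odd i == b) rk i =
    \sum_(i < n.+1 | odd i == b) rk i)%N.
  rewrite -!(big_mkord (fun i => odd i == b)) (big_cat_nat (n := n.+1)) //=.
  rewrite [X in (_ + X)%N]big_nat_cond [X in (_ + X)%N]big1 ?addn0 // => i.
  by case/andP=> /andP[ni _] _; apply: rk0.
have -> : r = (\sum_(i < n.+1 | odd i == odd j) rk i)%N.
  rewrite /r; case: (odd j); [rewrite EO|]; apply: eq_bigl => i; first by case: (odd i).
  by case: (odd i).
by rewrite -widen big_mkcond big_ord_recr -big_mkcond /=; case: (odd j); rewrite addn0.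
Qed.
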